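(* For every nonzero $f\in B^{b,+}_\infty$, write $f=\int_{s_0}^\infty[f_s]e^{-s}ds$ in canonical form. Then the formula $$|\rho|(f)=\lim_{\epsilon\to0+}|f_{s_0+\epsilon}|$$ defines a multiplicative map $|\rho|$ from the set of nonzero elements of $B^{b,+}_\infty$ to $(0,1]$.
   Context: For $x\in[-1,1]$, $[x]$ denotes the function of $z>0$ given by $[x](z)=\mathrm{sign}(x)|x|^z$ (and $[0]=0$). For $a,b\in\mathbb R$, $a\smile b=a$ means: $|a|\ge|b|$, and $a=b$ whenever $|a|=|b|$. $B^{b,+}_\infty$ is the real algebra (pointwise operations) of functions of $z>0$ of the form $\int_0^V[x_u]\,du$, where $V<\infty$ and $u\mapsto x_u\in[-1,1]$ is a measurable function of $u\in[0,V]$ such that $x_u\smile x_v=x_u$ for $u\le v$. Equivalently, it is the algebra of functions $f(z)=\int_0^\infty e^{-\xi z}d\mu(\xi)$ with $\mu$ a finite real Borel measure on $[0,\infty)$. Canonical form: every nonzero $f\in B^{b,+}_\infty$ can be written as $f=\int_{s_0}^\infty[f_s]e^{-s}ds$ with $s_0\in\mathbb R$ and $s\mapsto f_s\in[-1,1]\setminus\{0\}$ a measurable function of $s>s_0$, such that $f_s\smile f_t=f_s$ for $s\le t$; $s_0$ is unique and $f_s$ is unique up to a set of Lebesgue measure zero. *)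

(* Defs.v *)
From HB Require Import structures.
From mathcomp Require Import all_boot all_order all_algebra.
From mathcomp Require Import all_classical all_reals all_analysis.

Set Implicit Arguments.
Unset Strict Implicit.
Unset Printing Implicit Defensive.

Import Order.TTheory GRing.Theory Num.Theory.
Import numFieldNormedType.Exports.

Local Open Scope classical_set_scope.
Local Open Scope ring_scope.

(* The sign-preserving power function [x] of z > 0; since Num.sg 0 = 0, it
   vanishes identically when x = 0. *)
Definition spow (R : realType) (x : R) (z : {posnum R}) : R :=
  Num.sg x * `|x| `^ z%:num.

(* The relation a \smile b = a. *)
Definition smile_left (R : realType) (a b : R) : Prop :=
  `|b| <= `|a| /\ (`|a| = `|b| -> a = b).

(* The algebra B^{b,+}_oo. Functions of z > 0 are honest functions on
   {posnum R}, so that their equality is equality at all z > 0. *)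
Definition Bbp (R : realType) : set ({posnum R} -> R) :=
  [set f | exists V : R, exists x : R -> R,
    [/\ 0 <= V,
        measurable_fun `[0, V] x,
        forall u : R, u \in `[0, V] -> -1 <= x u <= 1,
        forall u v : R, u \in `[0, V] -> v \in `[0, V] -> u <= v ->
          smile_left (x u) (x v) &
        forall z, f z = \int[lebesgue_measure]_(u in `[0, V]) spow (x u) z]].

Definition Bbp_nonzero (R : realType) : set ({posnum R} -> R) :=
  [set f | Bbp f /\ f <> (fun=> 0)].

(* f = \int_{s0}^oo [x_s] e^{-s} ds in canonical form; the values of x at
   s <= s0 are irrelevant. *)
Definition canonical_form (R : realType) (f : {posnum R} -> R)
    (s0 : R) (x : R -> R) : Prop :=
  [/\ measurable_fun `]s0, +oo[ x,
      forall s : R, s0 < s -> -1 <= x s <= 1 /\ x s != 0,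
      forall s t : R, s0 < s -> s <= t -> smile_left (x s) (x t) &
      forall z, f z =
        \int[lebesgue_measure]_(s in `]s0, +oo[) (spow (x s) z * expR (- s))].

(* |rho|(f), computed from a chosen canonical form of f (the default value of
   the choice is used only when f has none). *)
Definition absrho (R : realType) (f : {posnum R} -> R) : R :=
  let p := xget (0, fun=> 1) [set p : R * (R -> R) | canonical_form f p.1 p.2] in
  lim (`|p.2 (p.1 + eps)| @[eps --> 0^'+]).

(* Main.v *)
Require Import Defs.
From HB Require Import structures.
From mathcomp Require Import all_boot all_order all_algebra.
From mathcomp Require Import all_classical all_reals all_analysis.
From mathcomp Require Import measurable_realfun.
From mathcomp Require Import ring lra.

Set Implicit Arguments.
Unset Strict Implicit.
Unset Printing Implicit Defensive.

Import Order.TTheory GRing.Theory Num.Theory.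
Import numFieldNormedType.Exports.

Local Open Scope classical_set_scope.
Local Open Scope ring_scope.

(** Writing |x| = exp (- xi), an element of the algebra is a Laplace transform
    f(z) = int w X^z, where the weight w carries the sign and X = |x| takes
    values in [0, 1]; |rho|(f) is then the top of the support of the signed
    distribution of X under w. This number is visible on f alone: it is the
    least a > 0 with f(z) = O(a^z) (lemma [absrhoP]). Hence it does not depend
    on the canonical form, and multiplicativity says that rates of decay
    multiply, which is Titchmarsh's convolution theorem on a half-line.

    Rates of decay are turned into supports by Mikusinski's lemma
    [growth_tail_eq0]: if int w X^n = O(a^n), then w gives mass zero to
    {X >= y} for all y > a. Indeed 1 - exp (- n (X/y)^n) is a power series in
    X^n whose w-integral tends to 0, and it converges to the indicator of
    {X >= y}. Vanishing on all these half-lines gives vanishing against all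
    bounded functions of X [Rintegral_transfer].

    For Titchmarsh's theorem [titchmarsh_tails], suppose that fg = O(c^z).
    Derivatives of a Laplace transform decay at least as fast as the
    transform, so the identity
      (f g')^2 = (f g') (f g)' - (f g) (f' g')
    bounds the rate of f g' by the geometric mean of those of fg and of the
    second-order products. Thus the worst rate among the f^(n) g^(m) with
    n + m <= d is log-convex in d; being at most 1 for all d, it cannot
    increase [leibniz_array_dominated]. So every f^(n) g^(m) is O(y^z) for
    all y > c: on {X1 X2 >= y} all joint moments of ln X1 and ln X2 vanish, and
    undoing the moments one variable at a time leaves H1(s) H2(t) = 0 whenever
    s t > c, where H1 and H2 are the masses of {X1 >= s} and {X2 >= t}.
    Choosing s and t close to the tops of the two supports gives the lower
    bound for the rate of fg; the upper bound is immediate.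

    The algebra is closed under products because int int w1 w2 (X1 X2)^z can
    be written back as int_0^V [x_u] du: the sign of x_u is the sign of a Hahn
    decomposition of the distribution of X1 X2, and |x_u| is its quantile
    function [Bbp_laplace]. Canonical forms come from the change of variable
    u = W - exp (- s), where W is the end of the support of x. *)

(** * Integration against a weight *)

Section weighted_integrals.
Context d (T : measurableType d) (R : realType).
Variable mu : {measure set T -> \bar R}.
Implicit Types (w X phi zeta : T -> R).

Lemma integrable_mul_bounded w phi (M : R) :
  mu.-integrable setT (EFin \o w) -> measurable_fun setT phi ->
  (forall t, `|phi t| <= M) ->
  mu.-integrable setT (EFin \o (fun t => w t * phi t)).
Proof.
move=> iw mphi bphi.
apply: (@eq_integrable _ _ _ mu _ measurableT
  ((EFin \o w) \* (EFin \o phi))%E) => //.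
apply: integrableMl => //; exists M; split; first exact: num_real.
by move=> N MN t _ /=; rewrite (le_trans (bphi t))// ltW.
Qed.

Lemma measurable_weight w : mu.-integrable setT (EFin \o w) ->
  measurable_fun setT w.
Proof. by move=> /measurable_int/measurable_EFinP. Qed.

Lemma Rintegral_indic w (A : set T) :
  \int[mu]_(t in A) w t = \int[mu]_t (w t * \1_A t).
Proof. by rewrite Rintegral_mkcond patch_indic. Qed.

Lemma normr_Rintegral_mul_le w phi (M : R) :
  mu.-integrable setT (EFin \o w) -> measurable_fun setT phi ->
  (forall t, `|phi t| <= M) ->
  `|\int[mu]_t (w t * phi t)| <= M * \int[mu]_t `|w t|.
Proof.
move=> iw mphi bphi.
have iwp := integrable_mul_bounded iw mphi bphi.
apply: (le_trans (le_normr_Rintegral measurableT iwp)).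
have inw : mu.-integrable setT (EFin \o (fun t => `|w t|)).
  exact: (integrable_norm iw).
rewrite -RintegralZl//; apply: le_Rintegral => //.
- exact: (integrable_norm iwp).
- exact: (integrableZl measurableT M inw).
- by move=> t _; rewrite normrM mulrC ler_wpM2r.
Qed.

Lemma Rintegral_dominated_cvg (f_ : nat -> T -> R) (f g : T -> R) :
  (forall n, measurable_fun setT (f_ n)) ->
  (forall t, f_ n t @[n --> \oo] --> f t) ->
  mu.-integrable setT (EFin \o g) ->
  (forall n t, `|f_ n t| <= g t) ->
  \int[mu]_t f_ n t @[n --> \oo] --> \int[mu]_t f t.
Proof.
move=> mf cf ig fg.
have mF n : measurable_fun setT (EFin \o f_ n) by exact/measurable_EFinP.
have mf0 : measurable_fun setT f by apply: (measurable_fun_cvg mf) => t _; exact: cf.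
have [fi _] : [/\ mu.-integrable setT (EFin \o f),
  (\int[mu]_x `|(EFin \o f_ n) x - (EFin \o f) x|)%E @[n --> \oo] --> 0%E &
  (\int[mu]_x (EFin \o f_ n) x)%E @[n --> \oo] --> (\int[mu]_x (EFin \o f) x)%E].
  apply: (@dominated_convergence _ _ _ mu _ measurableT _ _ (EFin \o g)) => //.
  - exact/measurable_EFinP.
  - apply: aeW => t _; apply/fine_cvgP; split; [exact: nearW|exact: cf].
  - by apply: aeW => t n _; rewrite lee_fin fg.
rewrite -[X in _ --> X -> _]fineK; last exact: (integrable_fin_num _ fi).
by move/fine_cvgP => [].
Qed.

(** The partial sums are dominated by |w| exp B. *)
Lemma cvg_Rintegral_expR w zeta (B : R) :
  mu.-integrable setT (EFin \o w) -> measurable_fun setT zeta ->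
  (forall t, `|zeta t| <= B) ->
  \sum_(0 <= k < n) (k`!%:R^-1 * \int[mu]_t (w t * zeta t ^+ k)) @[n --> \oo]
    --> \int[mu]_t (w t * expR (zeta t)).
Proof.
move=> iw mz zB.
have bz k t : `|zeta t ^+ k| <= B ^+ k.
  by rewrite normrX lerXn2r// nnegrE// (le_trans _ (zB t)).
have iwz k : mu.-integrable setT (EFin \o (fun t => w t * zeta t ^+ k)).
  by apply: (integrable_mul_bounded iw _ (bz k)); exact: measurable_funX.
have sumE n : \sum_(0 <= k < n) (k`!%:R^-1 * \int[mu]_t (w t * zeta t ^+ k)) =
    \int[mu]_t (w t * series (exp_coeff (zeta t)) n).
  rewrite /series/= /exp_coeff/=; elim: n => [|n ih].
    rewrite big_nil; under eq_Rintegral do rewrite big_nil mulr0.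
    by rewrite Rintegral_cst// mul0r.
  rewrite big_nat_recr//= ih.
  under [RHS]eq_Rintegral do
    rewrite big_nat_recr//= mulrDr [_ / _]mulrC mulrCA.
  rewrite RintegralD//.
  - by rewrite RintegralZl.
  - have := @integrable_sum _ _ _ mu _ measurableT _ (index_iota 0 n) xpredT
      (fun k t => ((k`!%:R^-1)%:E * (w t * zeta t ^+ k)%:E)%E).
    move=> /(_ (fun k _ => integrableZl measurableT _ (iwz k))).
    apply: eq_integrable => // t _ /=.
    rewrite sumEFin mulr_sumr; congr (_%:E); apply: eq_bigr => k _.
    by rewrite mulrC -mulrA.
  - exact: (integrableZl measurableT _ (iwz n)).
under eq_cvg do rewrite sumE.
apply: (@Rintegral_dominated_cvg _ _ (fun t => `|w t| * expR B)).
- move=> n; apply: measurable_funM; first exact: measurable_weight.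
  rewrite /series/= /exp_coeff/=; apply: measurable_sum => k.
  by apply: measurable_funM => //; exact: measurable_funX.
- move=> t; apply: cvgM; first exact: cvg_cst.
  exact: is_cvg_series_exp_coeff.
- have := integrableZr measurableT (expR B) (integrable_norm iw).
  by apply: eq_integrable.
- move=> n t; rewrite normrM ler_wpM2l//.
  rewrite (@le_trans _ _ (series (exp_coeff `|zeta t|) n))//.
    rewrite /series/= /exp_coeff/= (le_trans (ler_norm_sum _ _ _))//.
    by apply: ler_sum => k _; rewrite normrM normrX normfV normr_nat.
  rewrite (@le_trans _ _ (expR `|zeta t|)) ?ler_expR//.
  apply: nondecreasing_cvgn_le; last exact: is_cvg_series_exp_coeff.
  by apply/nondecreasing_series => k _ _; exact: exp_coeff_ge0.
Qed.

(** This transfers geometric bounds on moments to exponentials: the series of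
    exp zeta - 1 has no constant term, so only the moments of positive order
    enter. *)
Lemma normr_Rintegral_expR1_le w zeta (B C b : R) :
  mu.-integrable setT (EFin \o w) -> measurable_fun setT zeta ->
  (forall t, `|zeta t| <= B) -> 0 <= b ->
  (forall k, `|\int[mu]_t (w t * zeta t ^+ k.+1)| <= C * b ^+ k.+1) ->
  `|\int[mu]_t (w t * (expR (zeta t) - 1))| <= C * (expR b - 1).
Proof.
move=> iw mz zB b0 Cb.
have C0 : 0 <= C * b.
  by have := Cb 0%N; rewrite !expr1; apply: le_trans.
have iwe : mu.-integrable setT (EFin \o (fun t => w t * expR (zeta t))).
  apply: (@integrable_mul_bounded _ _ (expR B)) => //.
    exact: measurableT_comp.
  move=> t; rewrite ger0_norm ?expR_ge0// ler_expR.
  by rewrite (le_trans (ler_norm _)).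
under eq_Rintegral do rewrite mulrBr mulr1.
rewrite RintegralB//.
have h := cvg_Rintegral_expR iw mz zB.
rewrite -(cvg_shiftS _) in h.
have {}h : \sum_(1 <= k < n.+1) (k`!%:R^-1 * \int[mu]_t (w t * zeta t ^+ k))
   @[n --> \oo] --> \int[mu]_t (w t * expR (zeta t)) - \int[mu]_t w t.
  rewrite (_ : (fun _ => _) = (fun n =>
    \sum_(0 <= k < n.+1) (k`!%:R^-1 * \int[mu]_t (w t * zeta t ^+ k)) -
     \int[mu]_t w t)); last first.
    apply/funext => n; rewrite [in RHS]big_ltn// fact0 invr1 mul1r.
    by under [in RHS]eq_Rintegral do rewrite expr0 mulr1; rewrite addrC addKr.
  by apply: cvgB => //; exact: cvg_cst.
move/cvg_norm : h => hn; rewrite -(cvg_lim (@Rhausdorff R) hn).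
apply: limr_le; first by apply/cvg_ex; eexists; exact: hn.
apply: nearW => n; apply: (le_trans (ler_norm_sum _ _ _)).
rewrite (@le_trans _ _ (C * \sum_(1 <= k < n.+1) exp_coeff b k))//.
  rewrite mulr_sumr big_nat [leRHS]big_nat; apply: ler_sum => -[//|k] _.
  rewrite normrM normfV normr_nat /exp_coeff/= mulrA mulrC.
  by rewrite ler_wpM2r.
have [->|bn0] := eqVneq b 0.
  rewrite expR0 subrr mulr0 big_nat big1 ?mulr0// => -[//|k] _.
  by rewrite /exp_coeff/= expr0n/= mul0r.
rewrite ler_wpM2l//; first by rewrite -(@pmulr_lge0 _ b)// lt_def bn0.
have : series (exp_coeff b) n.+1 <= expR b.
  apply: nondecreasing_cvgn_le; last exact: is_cvg_series_exp_coeff.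
  by apply/nondecreasing_series => k _ _; exact: exp_coeff_ge0.
rewrite /series/= big_ltn// [exp_coeff _ 0%N]/exp_coeff/= expr0 fact0 divr1.
by rewrite lerBrDl.
Qed.

End weighted_integrals.

(** * Mikusinski's lemma *)

(** Since r <= exp (- c) with c = 1 - r, the term is at most (n+1) exp (- c (n+1)),
    and exp (t/2) >= t/2 makes this O(1/n). *)
Lemma cvg_natmul_exprn0 (R : realType) (r : R) : 0 <= r < 1 ->
  n.+1%:R * r ^+ n.+1 @[n --> \oo] --> 0.
Proof.
move=> /andP[r0 r1]; pose c := 1 - r; have c0 : 0 < c by rewrite subr_gt0.
have rc : r <= expR (- c).
  by apply: le_trans (expR_ge1Dx _); rewrite /c opprB addrC subrK.
have c2 : 0 < c / 2 by rewrite divr_gt0.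
apply: (@squeeze_cvgr _ _ _ _ (cst 0) (fun n => (c / 2) ^- 2 * harmonic n)).
- apply: nearW => n; rewrite mulr_ge0 ?exprn_ge0//=.
  have n0 : 0 < n.+1%:R :> R by rewrite ltr0n.
  have cn0 : 0 < c / 2 * n.+1%:R by rewrite mulr_gt0.
  have rE : r ^+ n.+1 <= (expR (c / 2 * n.+1%:R) ^+ 2)^-1.
    rewrite -expRM_natl -expRN (le_trans (lerXn2r n.+1 _ _ rc)) ?nnegrE ?expR_ge0//.
    by rewrite -expRM_natl ler_expR le_eqVlt; apply/orP; left; apply/eqP; field.
  have Ec : (expR (c / 2 * n.+1%:R) ^+ 2)^-1 <= ((c / 2 * n.+1%:R) ^+ 2)^-1.
    rewrite lef_pV2 ?posrE ?exprn_gt0 ?expR_gt0// lerXn2r ?nnegrE ?expR_ge0 ?ltW//.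
    by rewrite (lt_le_trans _ (expR_ge1Dx _))// ltrDr.
  rewrite (le_trans (ler_wpM2l (ltW n0) (le_trans rE Ec)))//.
  rewrite le_eqVlt; apply/orP; left; apply/eqP; rewrite /harmonic/=.
  by field; rewrite ?pnatr_eq0// gt_eqF// gt_eqF.
- exact: cvg_cst.
- rewrite -[X in _ --> X](mulr0 ((c / 2) ^- 2)).
  by apply: cvgM; [exact: cvg_cst|exact: cvg_harmonic].
Qed.

Section mikusinski.
Context d (T : measurableType d) (R : realType).
Variable mu : {measure set T -> \bar R}.
Implicit Types (w X phi : T -> R).

(** Mikusinski's lemma. With zeta_n = - n (X/y)^n the integrals of
    w (exp zeta_n - 1) are at most C (exp (n (a/y)^n) - 1), which tends to 0,
    whereas exp zeta_n - 1 tends to minus the indicator of {X >= y}. The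
    factor n makes the limit equal to 1 on {X = y} too, so that atoms at y
    need no separate treatment. *)
Lemma growth_tail_eq0 w X (a B C y : R) :
  mu.-integrable setT (EFin \o w) -> measurable_fun setT X ->
  (forall t, 0 <= X t <= B) -> 0 <= a < y ->
  (forall n, `|\int[mu]_t (w t * X t ^+ n.+1)| <= C * a ^+ n.+1) ->
  \int[mu]_(t in X @^-1` `[y, +oo[) w t = 0.
Proof.
move=> iw mX XB /andP[a0 ay] Ca.
have y0 : 0 < y by rewrite (le_lt_trans a0).
have B0 (t : T) : 0 <= B by have /andP[/le_trans + ] := XB t; apply.
pose zeta n (t : T) := - (n.+1%:R * (X t / y) ^+ n.+1).
have mzeta n : measurable_fun setT (zeta n).
  apply: measurableT_comp => //; apply: measurable_funM => //.
  by apply: measurable_funX; exact: measurable_funM.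
have zeta0 n t : zeta n t <= 0.
  have /andP[X0 _] := XB t.
  by rewrite oppr_le0 mulr_ge0// exprn_ge0// divr_ge0// ltW.
have bzeta n t : `|zeta n t| <= n.+1%:R * (B / y) ^+ n.+1.
  have /andP[X0 XtB] := XB t.
  have yV0 : 0 <= y^-1 by rewrite invr_ge0 ltW.
  rewrite ler0_norm// opprK ler_wpM2l// lerXn2r ?nnegrE ?mulr_ge0 ?(B0 t)//.
  by rewrite ler_wpM2r.
have ub n : `|\int[mu]_t (w t * (expR (zeta n t) - 1))| <=
    C * (expR (n.+1%:R * (a / y) ^+ n.+1) - 1).
  apply: (normr_Rintegral_expR1_le iw (mzeta n) (bzeta n)).
    by rewrite mulr_ge0// exprn_ge0// divr_ge0// ltW.
  move=> k; pose e := (- (n.+1%:R / y ^+ n.+1)) ^+ k.+1.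
  pose m := (n + k * n.+1)%N.
  have mE : m.+1 = (n.+1 * k.+1)%N by rewrite /m [in RHS]mulnS (mulnC k).
  have zE t : w t * zeta n t ^+ k.+1 = e * (w t * X t ^+ m.+1).
    rewrite mulrCA; congr (_ * _); rewrite mE exprM /e -exprMn; congr (_ ^+ _).
    by rewrite /zeta expr_div_n mulNr -mulrA [_^-1 * _]mulrC.
  under eq_Rintegral do rewrite zE.
  rewrite RintegralZl//; last first.
    apply: (@integrable_mul_bounded _ _ _ _ _ _ (B ^+ m.+1)) => //.
      exact: measurable_funX.
    move=> t; have /andP[X0 XtB] := XB t.
    by rewrite normrX lerXn2r ?nnegrE ?(B0 t)// ger0_norm.
  rewrite normrM (le_trans (ler_wpM2l _ (Ca m)))//.
  rewrite mulrCA mE exprM /e normrX normrN -exprMn ger0_norm.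
    by rewrite expr_div_n -mulrA [_^-1 * _]mulrC.
  by rewrite divr_ge0// exprn_ge0// ltW.
have cvg0 : \int[mu]_t (w t * (expR (zeta n t) - 1)) @[n --> \oo] --> 0.
  apply/norm_cvg0P; apply: (@squeeze_cvgr _ _ _ _ (cst 0)
    (fun n => C * (expR (n.+1%:R * (a / y) ^+ n.+1) - 1))).
  - by apply: nearW => n; rewrite normr_ge0/= ub.
  - exact: cvg_cst.
  - rewrite (_ : 0 = C * (expR 0 - 1)); last by rewrite expR0 subrr mulr0.
    apply: cvgM; first exact: cvg_cst.
    apply: cvgB; last exact: cvg_cst.
    apply: (@cvg_comp _ _ _ _ expR _ _ _ _ (@continuous_expR R 0)).
    by apply: cvg_natmul_exprn0; rewrite divr_ge0// ?ltr_pdivrMr ?mul1r// ltW.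
have cvgH : \int[mu]_t (w t * (expR (zeta n t) - 1)) @[n --> \oo] -->
    \int[mu]_t (w t * - \1_(X @^-1` `[y, +oo[) t).
  apply: (@Rintegral_dominated_cvg _ _ _ _ _ _ (fun t => `|w t|)).
  - move=> n; apply: measurable_funM; first exact: measurable_weight iw.
    by apply: measurable_funB => //; exact: measurableT_comp.
  - move=> t; apply: cvgM; first exact: cvg_cst.
    rewrite indicE; have /andP[X0 XtB] := XB t.
    have [yX|Xy] := leP y (X t).
      rewrite mem_set/=; last by rewrite in_itv/= yX.
      rewrite -[X in _ --> X]add0r; apply: cvgB; last exact: cvg_cst.
      apply: (@squeeze_cvgr _ _ _ _ (cst 0) (fun n => harmonic n)).
      + apply: nearW => n; rewrite expR_ge0/=.
        rewrite -[leLHS]invrK -expRN /zeta opprK /harmonic/=.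
        rewrite lef_pV2 ?posrE ?expR_gt0//.
        have: n.+1%:R <= n.+1%:R * (X t / y) ^+ n.+1.
          by rewrite ler_peMr// exprn_ege1// ler_pdivlMr// mul1r.
        move=> /le_trans; apply; apply: le_trans (expR_ge1Dx _).
        by rewrite lerDr.
      + exact: cvg_cst.
      + exact: cvg_harmonic.
    rewrite memNset/=; last by rewrite in_itv/= andbT; apply/negP; rewrite -ltNge.
    rewrite oppr0 (_ : 0 = expR 0 - 1); last by rewrite expR0 subrr.
    apply: cvgB; last exact: cvg_cst.
    apply: (@cvg_comp _ _ _ (zeta ^~ t) expR _ _ _ _ (@continuous_expR R 0)).
    have z0 : zeta n t @[n --> \oo] --> - (0 : R).
      apply: cvgN; apply: cvg_natmul_exprn0.
      by rewrite divr_ge0 ?ltr_pdivrMr ?mul1r// ltW.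
    by move: z0; rewrite oppr0.
  - exact: integrable_norm iw.
  - move=> n t; rewrite normrM ler_piMr// ler_norml.
    rewrite lerBrDr addNr expR_ge0 lerBlDr (@le_trans _ _ 1)//.
      by rewrite -expR0 ler_expR.
    by rewrite lerDr.
have : 0 = \int[mu]_t (w t * - \1_(X @^-1` `[y, +oo[) t).
  by rewrite -(cvg_lim (@Rhausdorff R) cvgH) (cvg_lim (@Rhausdorff R) cvg0).
under eq_Rintegral do rewrite mulrN -mulN1r.
rewrite RintegralZl//; last first.
  have mA : measurable (X @^-1` `[y, +oo[).
    by rewrite -[X in measurable X]setTI; exact: mX.
  apply: (@integrable_mul_bounded _ _ _ _ _ _ 1) => //.
  by move=> t; rewrite indicE; case: (_ \in _); rewrite ?normr1 ?normr0.
by rewrite mulN1r [in X in _ -> X]Rintegral_indic => /esym/eqP; rewrite oppr_eq0 => /eqP.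
Qed.
End mikusinski.

(** * Comparing two signed distributions *)

Section transfer.
Context d1 (T1 : measurableType d1) d2 (T2 : measurableType d2) (R : realType).
Variables (mu1 : {measure set T1 -> \bar R}) (mu2 : {measure set T2 -> \bar R}).
Variables (w1 X1 : T1 -> R) (w2 X2 : T2 -> R).
Hypotheses (iw1 : mu1.-integrable setT (EFin \o w1))
  (iw2 : mu2.-integrable setT (EFin \o w2)).
Hypotheses (mX1 : measurable_fun setT X1) (mX2 : measurable_fun setT X2).
Hypothesis total12 : \int[mu1]_t w1 t = \int[mu2]_t w2 t.
Hypothesis tail12 : forall y,
  \int[mu1]_(t in X1 @^-1` `[y, +oo[) w1 t =
  \int[mu2]_(t in X2 @^-1` `[y, +oo[) w2 t.

Let mX1p A : measurable A -> measurable (X1 @^-1` A).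
Proof. by move=> mA; rewrite -[X in measurable X]setTI; exact: mX1. Qed.

Let mX2p A : measurable A -> measurable (X2 @^-1` A).
Proof. by move=> mA; rewrite -[X in measurable X]setTI; exact: mX2. Qed.

Let c1 : {charge set T1 -> \bar R} := induced_charge iw1.
Let c2 : {charge set T2 -> \bar R} := induced_charge iw2.
Let nu1 A := c1 (X1 @^-1` A).
Let nu2 A := c2 (X2 @^-1` A).

Let fin1 A : measurable A -> nu1 A \is a fin_num.
Proof. by move=> mA; apply: fin_num_measure; exact: mX1p. Qed.

Let fin2 A : measurable A -> nu2 A \is a fin_num.
Proof. by move=> mA; apply: fin_num_measure; exact: mX2p. Qed.

Let nu12 A : measurable A -> fine (nu1 A) = fine (nu2 A) -> nu1 A = nu2 A.
Proof. by move=> mA h; rewrite -[LHS]fineK ?h ?fineK ?fin1 ?fin2. Qed.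

Let nu12T : nu1 setT = nu2 setT.
Proof. by apply: nu12 => //; rewrite /nu1 /nu2 /induced_charge !preimage_setT. Qed.

Let eq_nu A : measurable A -> nu1 A = nu2 A.
Proof.
move=> mA.
have GE : @measurable _ (measurableTypeR R) = <<s @RGenCInfty.G R >>.
  exact: RGenCInfty.measurableE.
apply: (@dynkin_induction _ _ (@RGenCInfty.G R) (fun A => nu1 A = nu2 A)).
- exact: RGenCInfty.measurableE.
- move=> _ _ [x ->] [y ->]; exists (Num.max x y).
  by apply/seteqP; split => z /=; rewrite !in_itv/= !andbT ge_max => /andP.
- exact: nu12T.
- move=> _ [y ->]; apply: nu12 => //; exact: tail12.
- move=> S mS eS.
  have := chargeU c1 (mX1p mS) (measurableC (mX1p mS)) (setICr _).
  rewrite setUv preimage_setC -/(nu1 S) -/(nu1 (~` S)) -(preimage_setT X1) -/(nu1 setT) => h1.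
  have := chargeU c2 (mX2p mS) (measurableC (mX2p mS)) (setICr _).
  rewrite setUv preimage_setC -/(nu2 S) -/(nu2 (~` S)) -(preimage_setT X2) -/(nu2 setT) => h2.
  move: nu12T; rewrite h1 h2 eS => /(congr1 (fun z => z - nu2 S)%E).
  by rewrite ![(nu2 S + _)%E]addeC !addeK ?fin2.
- move=> F mF tF eF.
  have s1 : (\sum_(0 <= i < n) nu1 (F i))%E @[n --> \oo] --> nu1 (\bigcup_k F k).
    rewrite /nu1 preimage_bigcup; apply: charge_semi_sigma_additive.
    + by move=> n; exact: mX1p.
    + apply/trivIsetP => i j _ _ ij; rewrite -preimage_setI.
      by move/trivIsetP : tF => /(_ _ _ I I ij) ->; rewrite preimage_set0.
    + by rewrite -preimage_bigcup; apply: mX1p; exact: bigcup_measurable.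
  have s2 : (\sum_(0 <= i < n) nu2 (F i))%E @[n --> \oo] --> nu2 (\bigcup_k F k).
    rewrite /nu2 preimage_bigcup; apply: charge_semi_sigma_additive.
    + by move=> n; exact: mX2p.
    + apply/trivIsetP => i j _ _ ij; rewrite -preimage_setI.
      by move/trivIsetP : tF => /(_ _ _ I I ij) ->; rewrite preimage_set0.
    + by rewrite -preimage_bigcup; apply: mX2p; exact: bigcup_measurable.
  have s12 : (fun n => \sum_(0 <= i < n) nu1 (F i))%E =
             (fun n => \sum_(0 <= i < n) nu2 (F i))%E.
    by apply/funext => n; apply: eq_bigr => i _; exact: eF.
  rewrite s12 in s1.
  by rewrite -(cvg_lim (@ereal_hausdorff R) s1) -(cvg_lim (@ereal_hausdorff R) s2).
- by rewrite -GE.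
Qed.

Import HBSimple HBNNSimple.

Let transfer_nnsfun (g : {nnsfun R >-> R}) :
  \int[mu1]_t (w1 t * g (X1 t)) = \int[mu2]_t (w2 t * g (X2 t)).
Proof.
have sumE d (T : measurableType d) (mu : {measure set T -> \bar R}) (w X : T -> R)
  (iw : mu.-integrable setT (EFin \o w)) (mX : measurable_fun setT X) :
  \int[mu]_t (w t * g (X t)) = \sum_(k <- finmap.enum_fset (fset_set (range g)))
    (k * \int[mu]_(t in X @^-1` (g @^-1` [set k])) w t).
  have mA k : measurable (X @^-1` (g @^-1` [set k])).
    by rewrite -[X in measurable X]setTI; apply: mX => //.
  have ii k : mu.-integrable setT (EFin \o
      (fun t => w t * \1_(g @^-1` [set k]) (X t))).
    apply: (@integrable_mul_bounded _ _ _ _ _ _ 1) => //.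
      by apply: measurableT_comp => //.
    by move=> t; rewrite indicE; case: (_ \in _); rewrite ?normr1 ?normr0.
  have iki k : mu.-integrable setT
      (fun t => (k * (w t * \1_(g @^-1` [set k]) (X t)))%:E).
    exact: (integrableZl measurableT k (ii k)).
  transitivity (fine (\int[mu]_t \sum_(k <- finmap.enum_fset (fset_set (range g)))
      (k * (w t * \1_(g @^-1` [set k]) (X t)))%:E)%E).
    congr fine; apply: eq_integral => t _.
    rewrite sumEFin fimfunE fsbig_finite//= mulr_sumr; congr (_%:E).
    by apply: eq_bigr => k _; rewrite mulrCA.
  rewrite integral_sum// -sum_fine; last first.
    by move=> k _; apply: integrable_fin_num.
  by apply: eq_bigr => k _; rewrite Rintegral_indic -RintegralZl//; exact: ii.
rewrite (sumE _ _ _ _ _ iw1 mX1) (sumE _ _ _ _ _ iw2 mX2).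
apply: eq_bigr => k _; congr (_ * _); congr fine.
exact: eq_nu.
Qed.

Let transfer_ge0 (phi : R -> R) (M : R) : measurable_fun setT phi ->
  (forall y, 0 <= phi y <= M) ->
  \int[mu1]_t (w1 t * phi (X1 t)) = \int[mu2]_t (w2 t * phi (X2 t)).
Proof.
move=> mphi phiM.
have mE : measurable_fun setT (EFin \o phi) by exact/measurable_EFinP.
pose g := nnsfun_approx measurableT mE.
have E0 x : setT x -> (0 <= (EFin \o phi) x)%E.
  by move=> _; have /andP[] := phiM x.
have gphi n y : `|g n y| <= M.
  rewrite ger0_norm//; have /andP[_] := phiM y; apply: le_trans.
  by rewrite -lee_fin /g nnsfun_approxE (le_approx n E0).
have cg y : g n y @[n --> \oo] --> phi y.
  by have /fine_cvgP[] := cvg_nnsfun_approx measurableT mE E0 (I : setT y).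
have cvgI d (T : measurableType d) (mu : {measure set T -> \bar R}) (w X : T -> R)
    (iw : mu.-integrable setT (EFin \o w)) (mX : measurable_fun setT X) :
  \int[mu]_t (w t * g n (X t)) @[n --> \oo] --> \int[mu]_t (w t * phi (X t)).
  apply: (@Rintegral_dominated_cvg _ _ _ _ _ _ (fun t => `|w t| * M)).
  - move=> n; apply: measurable_funM; first exact: measurable_weight iw.
    by apply: measurableT_comp => //.
  - by move=> t; apply: cvgM; [exact: cvg_cst|exact: cg].
  - have := integrableZr measurableT M (integrable_norm iw).
    by apply: eq_integrable.
  - by move=> n t; rewrite normrM ler_wpM2l.
have k1 := cvgI _ _ _ _ _ iw1 mX1; have k2 := cvgI _ _ _ _ _ iw2 mX2.
rewrite -(cvg_lim (@Rhausdorff R) k1) -(cvg_lim (@Rhausdorff R) k2).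
by congr (lim (_ @ \oo)); apply/funext => n; exact: transfer_nnsfun.
Qed.

(** Sets are reached from the half-lines {X >= y} by a pi-lambda argument, and
    bounded functions from sets by simple approximation. Besides uniqueness
    statements (with w2 = 0), this is used as a change of variables. *)
Lemma Rintegral_transfer (phi : R -> R) (M : R) : measurable_fun setT phi ->
  (forall y, `|phi y| <= M) ->
  \int[mu1]_t (w1 t * phi (X1 t)) = \int[mu2]_t (w2 t * phi (X2 t)).
Proof.
move=> mphi phiM.
have h : \int[mu1]_t (w1 t * (phi (X1 t) + M)) =
         \int[mu2]_t (w2 t * (phi (X2 t) + M)).
  apply: (@transfer_ge0 (fun y => phi y + M) (M + M)).
    exact: measurable_funD.
  move=> y; have := phiM y; rewrite ler_norml => /andP[h1 h2].
  by rewrite -lerBlDr sub0r h1 lerD2r.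
have splitE d (T : measurableType d) (mu : {measure set T -> \bar R}) (w X : T -> R)
    (iw : mu.-integrable setT (EFin \o w)) (mX : measurable_fun setT X) :
  \int[mu]_t (w t * (phi (X t) + M)) =
  \int[mu]_t (w t * phi (X t)) + \int[mu]_t w t * M.
  under eq_Rintegral do rewrite mulrDr.
  rewrite RintegralD ?RintegralZr//.
  - apply: (@integrable_mul_bounded _ _ _ _ _ _ M) => //.
    exact: measurableT_comp.
  - exact: (integrableZr measurableT M iw).
by move: h; rewrite !splitE// total12 => /addIr.
Qed.

End transfer.

(** * Weights with vanishing tails *)

Lemma normr_between_le (R : realDomainType) (a b x : R) : a <= x -> x <= b ->
  `|x| <= `|a| + `|b|.
Proof.
move=> ax xb; have := ler_norm (- a); have := ler_norm b; rewrite normrN.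
have := normr_ge0 a; have := normr_ge0 b; rewrite ler_norml; lra.
Qed.

Lemma Rintegral_indic_itvcc (R : realType) (a b : R) : a <= b ->
  \int[lebesgue_measure]_u \1_(`[a, b]%classic) u = b - a.
Proof.
move=> ab; transitivity (\int[lebesgue_measure]_(u in `[a, b]) (1 : R)).
  by rewrite [RHS]Rintegral_indic; apply: eq_Rintegral => u _; rewrite mul1r.
rewrite Rintegral_cst//= mul1r lebesgue_measure_itv/= lte_fin.
case: ifPn => [//|]; rewrite -leNgt => ba.
by apply/eqP; rewrite eq_sym subr_eq0 eq_le ab ba.
Qed.

Section growth.
Context d (T : measurableType d) (R : realType).
Variable mu : {measure set T -> \bar R}.
Implicit Types (w X : T -> R) (phi : R -> R).

Lemma measurable_preimage X (A : set R) : measurable_fun setT X ->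
  measurable A -> measurable (X @^-1` A).
Proof. by move=> mX mA; rewrite -[X in measurable X]setTI; exact: mX. Qed.

Lemma normr_indic_le1 (U : Type) (A : set U) (x : U) : `|\1_A x : R| <= 1.
Proof. by rewrite indicE; case: (_ \in _); rewrite ?normr1 ?normr0. Qed.

Lemma mul_indic (U : Type) (A B : set U) (x : U) :
  \1_A x * \1_B x = \1_(A `&` B) x :> R.
Proof. by rewrite indicI. Qed.

Lemma integrable_mul_indic w (A : set T) :
  mu.-integrable setT (EFin \o w) -> measurable A ->
  mu.-integrable setT (EFin \o (fun t => w t * \1_A t)).
Proof.
move=> iw mA; apply: (@integrable_mul_bounded _ _ _ _ _ _ 1) => //.
by move=> t; exact: normr_indic_le1.
Qed.

(** {X > a} is the increasing union of the {X >= a + 1/n}. *)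
Lemma open_tail_eq0 w X (a : R) :
  mu.-integrable setT (EFin \o w) -> measurable_fun setT X ->
  (forall y, a < y -> \int[mu]_(t in X @^-1` `[y, +oo[) w t = 0) ->
  \int[mu]_t (w t * \1_(X @^-1` `]a, +oo[) t) = 0.
Proof.
move=> iw mX tail0.
have cI : \int[mu]_t (w t * \1_(X @^-1` `[(a + harmonic n)%R, +oo[) t) @[n --> \oo]
    --> \int[mu]_t (w t * \1_(X @^-1` `]a, +oo[) t).
  apply: (@Rintegral_dominated_cvg _ _ _ _ _ _ (fun t => `|w t|)).
  - move=> n; apply: measurable_funM; first exact: measurable_weight iw.
    by apply: measurable_indic; exact: measurable_preimage.
  - move=> t; apply: cvgM; first exact: cvg_cst.
    have [aX|Xa] := ltP a (X t); last first.
      apply: cvg_near_cst; near=> n; rewrite !indicE !memNset//=.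
        by rewrite in_itv/= andbT; apply/negP; rewrite -leNgt.
      rewrite in_itv/= andbT; apply/negP; rewrite -ltNge.
      by rewrite (le_lt_trans Xa)// ltrDl invr_gt0.
    have Xa0 : 0 < X t - a by rewrite subr_gt0.
    have hX : \forall n \near \oo, harmonic n <= X t - a.
      exact: (cvgr_le 0 (@cvg_harmonic R)).
    apply: cvg_near_cst; near=> n; rewrite !indicE !mem_set//=.
      by rewrite in_itv/= aX.
    rewrite in_itv/= andbT -lerBrDl.
    by near: n.
  - exact: integrable_norm iw.
  - move=> n t; rewrite normrM ler_piMr//; exact: normr_indic_le1.
rewrite -(cvg_lim (@Rhausdorff R) cI); apply/cvg_lim => //.
apply: cvg_near_cst; apply: nearW => n.
by rewrite -Rintegral_indic tail0// ltrDl harmonic_gt0.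
Unshelve. all: by end_near. Qed.

Lemma tail_eq0_Rintegral w X (a M : R) phi :
  mu.-integrable setT (EFin \o w) -> measurable_fun setT X ->
  (forall y, a < y -> \int[mu]_(t in X @^-1` `[y, +oo[) w t = 0) ->
  measurable_fun setT phi -> (forall x, `|phi x| <= M) ->
  \int[mu]_t (w t * \1_(X @^-1` `]a, +oo[) t * phi (X t)) = 0.
Proof.
move=> iw mX tail0 mphi phiM.
have o0 := open_tail_eq0 iw mX tail0.
have iwo := integrable_mul_indic iw (measurable_preimage mX (measurable_itv `]a, +oo[)).
rewrite (@Rintegral_transfer _ _ _ _ _ mu mu _ X (cst 0) X _ _ _ _ _ _ phi M)//.
- by under eq_Rintegral do rewrite mul0r; rewrite Rintegral_cst// mul0r.
- exact: integrable0.
- by rewrite o0 Rintegral_cst// mul0r.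
- move=> y; rewrite [RHS]Rintegral_cst ?mul0r//; last exact: measurable_preimage.
  rewrite Rintegral_indic; have [ay|ya] := ltP a y.
    rewrite -[RHS](tail0 y ay) [in RHS]Rintegral_indic.
    apply: eq_Rintegral => t _; rewrite -mulrA; congr (_ * _).
    rewrite mul_indic; congr (\1_ _ t); apply/seteqP; split => z /=; first by case.
    by rewrite !in_itv/= !andbT => yz; split => //; exact: lt_le_trans yz.
  rewrite -[RHS]o0; apply: eq_Rintegral => t _; rewrite -mulrA; congr (_ * _).
  rewrite mul_indic; congr (\1_ _ t); apply/seteqP; split => z /=; first by case.
  by rewrite !in_itv/= !andbT => az; split => //; rewrite (le_trans ya)// ltW.
Qed.

Lemma tail_normr_Rintegral_le w X (a M K : R) phi :
  mu.-integrable setT (EFin \o w) -> measurable_fun setT X ->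
  (forall t, 0 <= X t) -> 0 <= K ->
  (forall y, a < y -> \int[mu]_(t in X @^-1` `[y, +oo[) w t = 0) ->
  measurable_fun setT phi -> (forall x, `|phi x| <= M) ->
  (forall x, 0 <= x <= a -> `|phi x| <= K) ->
  `|\int[mu]_t (w t * phi (X t))| <= K * \int[mu]_t `|w t|.
Proof.
move=> iw mX X0 K0 tail0 mphi phiM phiK.
have mA := measurable_preimage mX (measurable_itv `]a, +oo[).
have z0 := tail_eq0_Rintegral iw mX tail0 mphi phiM.
have mphiX : measurable_fun setT (fun t => phi (X t)) by exact: measurableT_comp.
rewrite -[X in `|X|]subr0 -z0 -RintegralB//; last 2 first.
- exact: (integrable_mul_bounded iw mphiX).
- by apply: (integrable_mul_bounded _ mphiX) => //; exact: integrable_mul_indic.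
under eq_Rintegral do rewrite -mulrA -mulrBr.
apply: normr_Rintegral_mul_le => //.
- by apply: measurable_funB => //; exact: measurable_funM.
- move=> t; rewrite indicE; have [aX|Xa] := ltP a (X t).
    by rewrite mem_set/= ?in_itv/= ?aX// mul1r subrr normr0.
  rewrite memNset/= ?mul0r ?subr0; last first.
    by rewrite in_itv/= andbT; apply/negP; rewrite -leNgt.
  by apply: phiK; rewrite Xa X0.
Qed.

(** By Mikusinski's lemma only the values of phi on [0, a] matter. For
    phi(x) = x^k ln x this says that differentiating a Laplace transform does
    not slow its decay down. *)
Lemma growth_normr_Rintegral_le w X (a B C M K : R) phi :
  mu.-integrable setT (EFin \o w) -> measurable_fun setT X ->
  (forall t, 0 <= X t <= B) -> 0 <= a ->
  (forall n, `|\int[mu]_t (w t * X t ^+ n.+1)| <= C * a ^+ n.+1) ->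
  measurable_fun setT phi -> (forall x, `|phi x| <= M) ->
  (forall x, 0 <= x <= a -> `|phi x| <= K) ->
  `|\int[mu]_t (w t * phi (X t))| <= K * \int[mu]_t `|w t|.
Proof.
move=> iw mX XB a0 Ca mphi phiM phiK.
apply: (@tail_normr_Rintegral_le _ _ a M) => //.
- by move=> t; case/andP: (XB t).
- by rewrite (le_trans _ (phiK 0 _))// lexx.
- by move=> y ay; apply: (growth_tail_eq0 iw mX XB _ Ca); rewrite a0.
Qed.

(** Summing the exponential series, the moments of ln X determine those of X,
    and Mikusinski's lemma applies with a = 0. *)
Lemma ln_moment_tail_eq0 w X (b B y : R) :
  mu.-integrable setT (EFin \o w) -> measurable_fun setT X ->
  0 < b -> (forall t, b <= X t <= B) ->
  (forall n, \int[mu]_t (w t * ln (X t) ^+ n) = 0) -> 0 < y ->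
  \int[mu]_(t in X @^-1` `[y, +oo[) w t = 0.
Proof.
move=> iw mX b0 XB mom0 y0.
have X0 t : 0 < X t by have /andP[+ _] := XB t; apply: lt_le_trans.
have bln t : `|ln (X t)| <= `|ln b| + `|ln B|.
  have /andP[bX XB'] := XB t.
  have h1 : ln b <= ln (X t) by rewrite ler_ln// posrE.
  have h2 : ln (X t) <= ln B by rewrite ler_ln// ?posrE ?X0// (lt_le_trans (X0 t)).
  exact: normr_between_le.
apply: (@growth_tail_eq0 _ _ _ mu w X 0 B 0 y iw mX) => //.
- by move=> t; have /andP[_ ->] := XB t; rewrite ltW.
- by rewrite lexx.
move=> n; rewrite mul0r normr_le0; apply/eqP.
have mln : measurable_fun setT (fun t => ln (X t)) by exact: measurableT_comp.
have := @cvg_Rintegral_expR _ _ _ mu w (fun t => n.+1%:R * ln (X t))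
  (n.+1%:R * (`|ln b| + `|ln B|)) iw.
have E t : expR (n.+1%:R * ln (X t)) = X t ^+ n.+1.
  by rewrite expRM_natl lnK ?posrE.
under [in X in _ -> _ -> X]eq_Rintegral do rewrite E.
move=> /(_ _ _)/(cvg_lim (@Rhausdorff R)) <-.
- apply/cvg_lim => //; apply: cvg_near_cst; apply: nearW => N.
  apply: big1 => k _; under eq_Rintegral do rewrite exprMn mulrCA.
  rewrite RintegralZl//; first by rewrite mom0 !mulr0.
  apply: (@integrable_mul_bounded _ _ _ _ _ _ ((`|ln b| + `|ln B|) ^+ k)) => //.
    exact: measurable_funX.
  by move=> t; rewrite normrX lerXn2r// nnegrE// (le_trans _ (bln t)).
- exact: measurable_funM.
- by move=> t; rewrite normrM ger0_norm// ler_wpM2l.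
Qed.

End growth.

(** * Log-convexity of rates of decay *)

Definition geom_dominated (R : realType) (u : nat -> R) (a : R) :=
  exists C, forall k, `|u k| <= C * a ^+ k.

Section geometric_domination.
Context (R : realType).
Implicit Types (u v : nat -> R) (a b y z : R).

Lemma geom_dominated_ge u a b : 0 <= a -> a <= b ->
  geom_dominated u a -> geom_dominated u b.
Proof.
move=> a0 ab [C uC]; exists C => k; rewrite (le_trans (uC k))//.
have C0 : 0 <= C by have := uC 0%N; rewrite expr0 mulr1; apply: le_trans.
by rewrite ler_wpM2l// lerXn2r// nnegrE// (le_trans a0).
Qed.

Lemma geom_dominated_mul u v a b :
  geom_dominated u a -> geom_dominated v b ->
  geom_dominated (fun k => u k * v k) (a * b).
Proof.
move=> [C uC] [D vD]; exists (C * D) => k.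
by rewrite normrM exprMn mulrACA ler_pM.
Qed.

Lemma geom_dominated_sub u v a :
  geom_dominated u a -> geom_dominated v a ->
  geom_dominated (fun k => u k - v k) a.
Proof.
move=> [C uC] [D vD]; exists (C + D) => k.
by rewrite (le_trans (ler_normB _ _))// mulrDl lerD.
Qed.

(** This is where rates of decay behave better than supports: the convolution
    square, the difficult special case of Titchmarsh's theorem, becomes
    trivial. *)
Lemma geom_dominated_sqrt u b : 0 <= b ->
  geom_dominated (fun k => u k ^+ 2) b -> geom_dominated u (Num.sqrt b).
Proof.
move=> b0 [C uC]; exists (Num.sqrt C) => k.
have C0 : 0 <= C.
  by have := uC 0%N; rewrite expr0 mulr1; apply: le_trans.
rewrite -(@ler_pXn2r _ 2)// ?nnegrE ?mulr_ge0 ?exprn_ge0 ?sqrtr_ge0//.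
rewrite exprMn sqr_sqrtr// -exprM mulnC exprM sqr_sqrtr//.
by rewrite -normrX.
Qed.

(** By log-convexity, a ratio q > 1 between two consecutive terms would persist,
    and the sequence would grow at least like q^j. *)
Lemma logconvex_bounded_le (kap : nat -> R) (M : R) :
  (forall n, 0 < kap n <= M) ->
  (forall n, kap n.+1 ^+ 2 <= kap n * kap n.+2) ->
  forall n, kap n <= kap 0%N.
Proof.
move=> kapM kaplc.
have k0 n : 0 < kap n by have /andP[] := kapM n.
have step n : kap n.+1 <= kap n.
  rewrite leNgt; apply/negP => knn.
  pose q := kap n.+1 / kap n.
  have q1 : 1 < q by rewrite ltr_pdivlMr// mul1r.
  have q0 : 0 < q by rewrite (lt_trans _ q1).
  have ratio j : q * kap (n + j)%N <= kap (n + j).+1.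
    elim: j => [|j ih]; first by rewrite addn0 divfK// gt_eqF.
    rewrite addnS -(@ler_pM2l _ (kap (n + j)%N))//.
    apply: le_trans (kaplc (n + j)%N); rewrite mulrCA expr2 mulrA.
    by rewrite ler_wpM2r// ltW.
  have growth j : kap n * q ^+ j <= kap (n + j)%N.
    elim: j => [|j ih]; first by rewrite addn0 expr0 mulr1.
    by rewrite addnS exprS mulrCA (le_trans _ (ratio j))// ler_wpM2l// ltW.
  have bern j : 1 + j%:R * (q - 1) <= q ^+ j.
    elim: j => [|j ih]; first by rewrite mul0r addr0 expr0.
    rewrite exprS (le_trans _ (ler_wpM2l (ltW q0) ih))//.
    rewrite -natr1; have : 0 <= j%:R * (q - 1) ^+ 2.
      by rewrite mulr_ge0// sqr_ge0.
    nra.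
  pose e := kap n * (q - 1).
  have e0 : 0 < e by rewrite mulr_gt0// subr_gt0.
  pose j := Num.bound `|M / e|.
  have Mj : M < j%:R * e.
    by rewrite -ltr_pdivrMr// (le_lt_trans (ler_norm _))// archi_boundP.
  have /andP[_ kM] := kapM (n + j)%N.
  have := le_trans (growth j) kM.
  have := ler_wpM2l (ltW (k0 n)) (bern j).
  rewrite mulrDr mulr1 mulrCA -/e.
  have := k0 n; lra.
by elim=> // n ih; exact: le_trans ih.
Qed.

Section leibniz_array.
(** [A n m] models the product f^(n) g^(m) of derivatives of two Laplace
    transforms. [A_deriv] is the Leibniz rule for (f^(n) g^(m))' together with
    the fact that differentiation preserves decay. *)
Variables (A : nat -> nat -> nat -> R) (c : R).
Hypothesis c01 : 0 < c <= 1.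
Hypothesis A_bounded : forall n m, geom_dominated (A n m) 1.
Hypothesis A_cross : forall n m n' m' k,
  A n m k * A n' m' k = A n m' k * A n' m k.
Hypothesis A_deriv : forall n m y, 0 <= y -> geom_dominated (A n m) y ->
  geom_dominated (fun k => A n.+1 m k + A n m.+1 k) y.
Hypothesis A00 : geom_dominated (A 0%N 0%N) c.

Let c0 : 0 < c. Proof. by case/andP: c01. Qed.

Let P d : set R :=
  [set y | c <= y /\ forall n m, (n + m <= d)%N -> geom_dominated (A n m) y].

Let P1 d : P d 1.
Proof. by split=> [|n m _]; [case/andP: c01|exact: A_bounded]. Qed.

Let Plb d : lbound (P d) c. Proof. by move=> y []. Qed.

(* Restricting to y >= c in P keeps the infima positive. *)
Let kap d := inf (P d).

Let kap_bound d : c <= kap d <= 1.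
Proof.
apply/andP; split; first by apply: lb_le_inf; [exists 1; exact: P1|exact: Plb].
by apply: ge_inf; [exists c; exact: Plb|exact: P1].
Qed.

Let P_gt d y : kap d < y -> P d y.
Proof.
move=> ky; have y0 : 0 < y - kap d by rewrite subr_gt0.
have [|z [cz Pz] zy] := @inf_adherent _ (P d) (y - kap d) y0.
  by split; [exists 1; exact: P1|exists c; exact: Plb].
rewrite -/(kap d) addrC subrK in zy.
split; first by rewrite (le_trans cz)// ltW.
move=> n m nm; apply: geom_dominated_ge (Pz _ _ nm); last exact: ltW.
by rewrite (le_trans (ltW c0)).
Qed.

(** For n = m = 0 this is (f g')^2 = (f g') (f g)' - (f g) (f' g') and its mirror
    image. *)
Let midpoint n m y z : 0 < y -> 0 < z -> geom_dominated (A n m) y ->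
  geom_dominated (A n.+1 m) z -> geom_dominated (A n m.+1) z ->
  geom_dominated (A n.+1 m.+1) z ->
  geom_dominated (A n.+1 m) (Num.sqrt (y * z)) /\
  geom_dominated (A n m.+1) (Num.sqrt (y * z)).
Proof.
move=> y0 z0 h00 h10 h01 h11.
have hD := A_deriv (ltW y0) h00.
have hP := geom_dominated_mul h00 h11.
have yz0 : 0 <= y * z by rewrite ltW// mulr_gt0.
split; apply: geom_dominated_sqrt => //.
- have := geom_dominated_sub (geom_dominated_mul hD h10) hP.
  congr geom_dominated; apply/funext => k.
  rewrite (A_cross n m n.+1 m.+1); ring.
- have := geom_dominated_sub (geom_dominated_mul hD h01) hP.
  congr geom_dominated; apply/funext => k.
  rewrite (A_cross n m n.+1 m.+1); ring.
Qed.

Let kap_logconvex d : kap d.+1 ^+ 2 <= kap d * kap d.+2.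
Proof.
have kc e : 0 < kap e by case/andP: (kap_bound e) => /(lt_le_trans c0).
have main y z : kap d < y -> kap d.+2 < z -> kap d.+1 ^+ 2 <= y * z.
  move=> ky kz; have [cy Py] := P_gt ky; have [cz Pz] := P_gt kz.
  have y0 : 0 < y := lt_le_trans c0 cy.
  have z0 : 0 < z := lt_le_trans c0 cz.
  have yz0 : 0 <= y * z by rewrite ltW// mulr_gt0.
  rewrite -[leRHS]sqr_sqrtr// ler_pXn2r ?nnegrE ?sqrtr_ge0 ?(ltW (kc _))//.
  apply: ge_inf; first by exists c; exact: Plb.
  split.
    rewrite -(@ler_pXn2r _ 2) ?nnegrE ?sqrtr_ge0 ?(ltW c0)// sqr_sqrtr//.
    by rewrite expr2 ler_pM// ltW.
  move=> n m; rewrite leq_eqVlt => /predU1P[nm|nm]; last first.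
    apply: geom_dominated_sqrt => //; under [X in geom_dominated X]eq_fun do rewrite expr2.
    by apply: geom_dominated_mul; [apply: Py|apply: Pz; rewrite ltnW// ltnW].
  case: n nm => [|n] nm.
    rewrite add0n in nm; rewrite nm.
    by apply: (midpoint (n := 0) (m := d) y0 z0 _ _ _ _).2;
      [apply: Py|apply: Pz|apply: Pz|apply: Pz];
      rewrite ?addnS ?addSn ?add0n ?addn0.
  rewrite addSn in nm; case: nm => nm.
  by apply: (midpoint y0 z0 _ _ _ _).1; [apply: Py|apply: Pz|apply: Pz|apply: Pz];
      rewrite ?addnS ?addSn nm.
have dk y : kap d < y -> kap d.+1 ^+ 2 <= y * kap d.+2.
  move=> ky; have y0 : 0 < y := lt_trans (kc d) ky.
  rewrite -ler_pdivrMl//; apply/unstable.ler_gtP => z kz.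
  by rewrite ler_pdivrMl// main.
rewrite -ler_pdivrMr//; apply/unstable.ler_gtP => y ky.
by rewrite ler_pdivrMr// dk.
Qed.

Lemma leibniz_array_dominated y n m : c < y -> geom_dominated (A n m) y.
Proof.
move=> cy; suff /P_gt[_]: kap (n + m)%N < y by apply.
apply: le_lt_trans cy.
rewrite (@le_trans _ _ (kap 0%N))//.
  apply: (@logconvex_bounded_le _ 1) => // e.
  by case/andP: (kap_bound e) => /(lt_le_trans c0) -> ->.
apply: ge_inf; first by exists c; exact: Plb.
by split=> // n' m'; rewrite leqn0 addn_eq0 => /andP[/eqP-> /eqP->].
Qed.

End leibniz_array.
End geometric_domination.

(** * Titchmarsh's theorem for tails *)

Section titchmarsh.
Context d1 (T1 : measurableType d1) d2 (T2 : measurableType d2) (R : realType).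
Variables (mu1 : {sigma_finite_measure set T1 -> \bar R}).
Variables (mu2 : {sigma_finite_measure set T2 -> \bar R}).

Lemma integrable_prod (u : T1 -> R) (v : T2 -> R) :
  mu1.-integrable setT (EFin \o u) -> mu2.-integrable setT (EFin \o v) ->
  (mu1 \x mu2)%E.-integrable setT (EFin \o (fun p => u p.1 * v p.2)).
Proof.
move=> iu iv.
have mu := measurable_weight iu; have mv := measurable_weight iv.
have muv : measurable_fun setT (EFin \o (fun p : T1 * T2 => u p.1 * v p.2)).
  apply/measurable_EFinP; apply: measurable_funM.
    by apply: measurableT_comp => //; exact: measurable_fst.
  by apply: measurableT_comp => //; exact: measurable_snd.
apply/(integrable12ltyP mu1 mu2 muv) => /=.
have inv := integrable_norm iv; have inu := integrable_norm iu.
have E x : (\int[mu2]_y `|u x * v y|%:E)%E = (`|u x| * \int[mu2]_y `|v y|)%:E.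
  under eq_integral do rewrite normrM EFinM.
  by rewrite integralZl// EFinM fineK// integrable_fin_num.
under eq_integral do rewrite E.
exact: (integrable_lty _ (integrableZr measurableT (\int[mu2]_y `|v y|) inu)).
Qed.

Lemma Rintegral_prod (u : T1 -> R) (v : T2 -> R) :
  mu1.-integrable setT (EFin \o u) -> mu2.-integrable setT (EFin \o v) ->
  \int[(mu1 \x mu2)%E]_p (u p.1 * v p.2) = \int[mu1]_x u x * \int[mu2]_y v y.
Proof.
move=> iu iv; rewrite -RintegralZr//; congr fine.
rewrite -(integral12_prod_meas1 (integrable_prod iu iv)).
apply: eq_integral => x _; rewrite /fubini_F/=.
under eq_integral do rewrite EFinM.
by rewrite integralZl// EFinM fineK// integrable_fin_num.
Qed.

Variables (w1 X1 : T1 -> R) (w2 X2 : T2 -> R) (b : R).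
Hypotheses (iw1 : mu1.-integrable setT (EFin \o w1))
  (iw2 : mu2.-integrable setT (EFin \o w2)).
Hypotheses (mX1 : measurable_fun setT X1) (mX2 : measurable_fun setT X2).
Hypotheses (b0 : 0 < b) (X1b : forall t, b <= X1 t <= 1)
  (X2b : forall t, b <= X2 t <= 1).

Let W1 n x := w1 x * ln (X1 x) ^+ n.
Let W2 n y := w2 y * ln (X2 y) ^+ n.

Let ln_bound x : b <= x <= 1 -> `|ln x| <= `|ln b|.
Proof.
move=> /andP[bx x1]; have x0 : 0 < x := lt_le_trans b0 bx.
have lx0 : ln x <= 0 by rewrite -ln1 ler_ln ?posrE.
have lbx : ln b <= ln x by rewrite ler_ln ?posrE.
by rewrite !ler0_norm ?lerN2// (le_trans lbx).
Qed.

Let iW1 n : mu1.-integrable setT (EFin \o W1 n).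
Proof.
apply: (@integrable_mul_bounded _ _ _ _ _ _ (`|ln b| ^+ n)) => //.
  by apply: measurable_funX; apply: measurableT_comp => //; exact: measurable_ln.
by move=> t; rewrite normrX lerXn2r ?nnegrE// ln_bound.
Qed.

Let iW2 n : mu2.-integrable setT (EFin \o W2 n).
Proof.
apply: (@integrable_mul_bounded _ _ _ _ _ _ (`|ln b| ^+ n)) => //.
  by apply: measurable_funX; apply: measurableT_comp => //; exact: measurable_ln.
by move=> t; rewrite normrX lerXn2r ?nnegrE// ln_bound.
Qed.

Let F n k := \int[mu1]_x (W1 n x * X1 x ^+ k).
Let G m k := \int[mu2]_y (W2 m y * X2 y ^+ k).

Let X1k k t : `|X1 t ^+ k| <= 1.
Proof.
have /andP[bX X1'] := X1b t; have X0 := ltW (lt_le_trans b0 bX).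
by rewrite ger0_norm ?exprn_ge0// exprn_ile1.
Qed.

Let X2k k t : `|X2 t ^+ k| <= 1.
Proof.
have /andP[bX X2'] := X2b t; have X0 := ltW (lt_le_trans b0 bX).
by rewrite ger0_norm ?exprn_ge0// exprn_ile1.
Qed.

Let iF n k : mu1.-integrable setT (EFin \o (fun x => W1 n x * X1 x ^+ k)).
Proof. by apply: (integrable_mul_bounded _ _ (X1k k)) => //; exact: measurable_funX. Qed.

Let iG n k : mu2.-integrable setT (EFin \o (fun x => W2 n x * X2 x ^+ k)).
Proof. by apply: (integrable_mul_bounded _ _ (X2k k)) => //; exact: measurable_funX. Qed.

Let W n m (p : T1 * T2) := W1 n p.1 * W2 m p.2.
Let X (p : T1 * T2) := X1 p.1 * X2 p.2.

Let iW n m : (mu1 \x mu2)%E.-integrable setT (EFin \o W n m).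
Proof. exact: integrable_prod. Qed.

Let mX1' : measurable_fun setT (fun p : T1 * T2 => X1 p.1).
Proof. by apply: measurableT_comp => //; exact: measurable_fst. Qed.

Let mX2' : measurable_fun setT (fun p : T1 * T2 => X2 p.2).
Proof. by apply: measurableT_comp => //; exact: measurable_snd. Qed.

Let mX : measurable_fun setT X.
Proof. exact: measurable_funM. Qed.

Let Xb p : b * b <= X p <= 1.
Proof.
have /andP[h1 h2] := X1b p.1; have /andP[h3 h4] := X2b p.2.
have h5 := ltW b0; rewrite /X ler_pM//= mulr_ile1// ?(le_trans h5)//.
Qed.

Let X01 p : 0 <= X p <= 1.
Proof. by have /andP[h ->] := Xb p; rewrite (le_trans _ h)// mulr_ge0// ltW. Qed.

Let FGE n m k : F n k * G m k = \int[(mu1 \x mu2)%E]_p (W n m p * X p ^+ k).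
Proof.
rewrite -Rintegral_prod//; apply: eq_Rintegral => p _.
by rewrite /W /X exprMn mulrACA.
Qed.

(* The function x^k ln x is cut off outside [b^2, 1], which contains the values
   of X1 X2, in order to make it bounded. *)
Let FG_deriv n m y : 0 <= y -> geom_dominated (fun k => F n k * G m k) y ->
  geom_dominated (fun k => F n.+1 k * G m k + F n k * G m.+1 k) y.
Proof.
move=> y0 [C FGC].
exists (`|ln (b * b)| * \int[(mu1 \x mu2)%E]_p `|W n m p|) => k.
have bb0 : 0 < b * b by rewrite mulr_gt0.
pose phi x := \1_(`[b * b, 1]%classic) x * (ln x * x ^+ k).
have phiX p : phi (X p) = ln (X p) * X p ^+ k.
  by rewrite /phi indicE mem_set/= ?mul1r// in_itv/= Xb.
have phi0 x : (x \in `[b * b, 1]) = false -> phi x = 0.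
  by move=> h; rewrite /phi indicE memNset ?mul0r//= h.
have lnx x : x \in `[b * b, 1] -> `|ln x| <= `|ln (b * b)|.
  rewrite in_itv/= => /andP[bx x1]; have x0 := lt_le_trans bb0 bx.
  have lx0 : ln x <= 0 by rewrite -ln1 ler_ln ?posrE.
  have lbx : ln (b * b) <= ln x by rewrite ler_ln ?posrE.
  by rewrite !ler0_norm ?lerN2// (le_trans lbx).
have phiin x : x \in `[b * b, 1] -> phi x = ln x * x ^+ k.
  by move=> h; rewrite /phi indicE mem_set/= ?mul1r.
have iWX j q : (mu1 \x mu2)%E.-integrable setT
    (EFin \o (fun p => W j q p * X p ^+ k)).
  apply: (@integrable_mul_bounded _ _ _ _ _ _ 1) => //; first exact: measurable_funX.
  move=> p; have /andP[h1 h2] := X01 p.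
  by rewrite ger0_norm ?exprn_ge0// exprn_ile1.
have -> : F n.+1 k * G m k + F n k * G m.+1 k =
    \int[(mu1 \x mu2)%E]_p (W n m p * phi (X p)).
  rewrite !FGE -RintegralD//; apply: eq_Rintegral => p _.
  rewrite phiX /X lnM ?posrE; last 2 first.
  - by have /andP[+ _] := X1b p.1; apply: lt_le_trans.
  - by have /andP[+ _] := X2b p.2; apply: lt_le_trans.
  by rewrite /W /W1 /W2 !exprS; ring.
rewrite mulrAC.
apply: (@growth_normr_Rintegral_le _ _ _ _ _ X y 1 C `|ln (b * b)|) => //.
- by move=> j; rewrite -FGE.
- apply: measurable_funM; first exact: measurable_indic.
  by apply: measurable_funM => //; exact: measurable_ln.
- move=> x; case h: (x \in `[b * b, 1]); last by rewrite phi0// normr0.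
  rewrite phiin// normrM (le_trans _ (lnx _ h))// ler_piMr//.
  move: h; rewrite in_itv/= => /andP[bx x1].
  by rewrite ger0_norm ?exprn_ge0 ?exprn_ile1// (le_trans (ltW bb0)).
- move=> x /andP[x0 xy]; case h: (x \in `[b * b, 1]); last first.
    by rewrite phi0// normr0 mulr_ge0// exprn_ge0.
  rewrite phiin// normrM ler_pM// ?lnx// ger0_norm ?exprn_ge0//.
  by rewrite lerXn2r// nnegrE.
Qed.

(** Logarithmic weights play the role of derivatives: W1 n weighted by X1^k is the
    n-th derivative of the transform of w1 at k. The lower bound b on X1 and
    X2 keeps these weights integrable. All joint moments of ln X1 and ln X2
    vanish on {X1 X2 >= s t}, which contains {X1 >= s, X2 >= t}. *)
Lemma titchmarsh_tails c s t : 0 < c <= 1 ->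
  geom_dominated (fun k => \int[mu1]_x (w1 x * X1 x ^+ k) *
                           \int[mu2]_y (w2 y * X2 y ^+ k)) c ->
  0 < s -> 0 < t -> c < s * t ->
  \int[mu1]_(x in X1 @^-1` `[s, +oo[) w1 x *
  \int[mu2]_(y in X2 @^-1` `[t, +oo[) w2 y = 0.
Proof.
move=> c01 FGc s0 t0 cst.
have c0 : 0 < c by case/andP: c01.
have dom n m y : c < y -> geom_dominated (fun k => F n k * G m k) y.
  apply: (@leibniz_array_dominated R (fun n m k => F n k * G m k) c c01).
  - move=> i j; exists (\int[(mu1 \x mu2)%E]_p `|W i j p|) => k.
    rewrite expr1n mulr1 FGE -[leRHS]mul1r; apply: normr_Rintegral_mul_le => //.
      exact: measurable_funX.
    move=> p; have /andP[h1 h2] := X01 p.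
    by rewrite ger0_norm ?exprn_ge0// exprn_ile1.
  - by move=> i j i' j' k; ring.
  - exact: FG_deriv.
  - have := FGc; congr geom_dominated; apply/funext => k; congr (_ * _).
      by apply: eq_Rintegral => x _; rewrite /W1 expr0 mulr1.
    by apply: eq_Rintegral => x _; rewrite /W2 expr0 mulr1.
have tailW n m : \int[(mu1 \x mu2)%E]_(p in X @^-1` `[s * t, +oo[) W n m p = 0.
  have [y cy yst] : exists2 y, c < y & y < s * t.
    by exists ((c + s * t) / 2); [rewrite ltr_pdivlMr|rewrite ltr_pdivrMr] => //; lra.
  have [C FGC] := dom n m y cy.
  apply: (@growth_tail_eq0 _ _ _ _ _ X y 1 C) => //.
    by rewrite yst ltW// (lt_trans c0).
  by move=> k; rewrite -FGE.
pose A := X @^-1` `[s * t, +oo[.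
pose B1 := (fun p : T1 * T2 => X1 p.1) @^-1` `[s, +oo[.
pose B2 := (fun p : T1 * T2 => X2 p.2) @^-1` `[t, +oo[.
have mA : measurable A by exact: measurable_preimage.
have mB1 : measurable B1 by exact: measurable_preimage.
have mB2 : measurable B2 by exact: measurable_preimage.
have tailW1 m : \int[(mu1 \x mu2)%E]_(p in B1) (W 0 m p * \1_A p) = 0.
  apply: (@ln_moment_tail_eq0 _ _ _ _ _ (fun p : T1 * T2 => X1 p.1) b 1) => //.
  - exact: integrable_mul_indic.
  - move=> n; rewrite -[RHS](tailW n m) [RHS]Rintegral_indic.
    by apply: eq_Rintegral => p _; rewrite /W /W1 expr0; ring.
have tailW2 : \int[(mu1 \x mu2)%E]_(p in B2) (W 0 0 p * \1_A p * \1_B1 p) = 0.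
  apply: (@ln_moment_tail_eq0 _ _ _ _ _ (fun p : T1 * T2 => X2 p.2) b 1) => //.
  - by apply: integrable_mul_indic => //; exact: integrable_mul_indic.
  - move=> m; rewrite -[RHS](tailW1 m) [RHS]Rintegral_indic.
    by apply: eq_Rintegral => p _; rewrite /W /W2 expr0; ring.
rewrite [X in X * _]Rintegral_indic [X in _ * X]Rintegral_indic.
rewrite -Rintegral_prod//; last 2 first.
- by apply: integrable_mul_indic => //; exact: measurable_preimage.
- by apply: integrable_mul_indic => //; exact: measurable_preimage.
rewrite -[RHS]tailW2 [RHS]Rintegral_indic; apply: eq_Rintegral => p _.
rewrite -[RHS]mulrA -[in RHS](mulrA (W 0 0 p)).
have -> : \1_A p * (\1_B1 p * \1_B2 p) =
    \1_(X1 @^-1` `[s, +oo[) p.1 * \1_(X2 @^-1` `[t, +oo[) p.2 :> R.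
  rewrite mul_indic mul_indic.
  have -> : A `&` (B1 `&` B2) = B1 `&` B2.
    apply/seteqP; split => q; first by case.
    move=> [q1 q2]; split=> //; move: q1 q2.
    rewrite /A /B1 /B2 /X /= !in_itv/= !andbT => q1 q2.
    by rewrite ler_pM// ltW.
  by rewrite -mul_indic.
rewrite /W /W1 /W2 !expr0; ring.
Qed.

End titchmarsh.

(** * Sign and quantile function of a signed distribution *)

Section laplace_representation.
Context d (T : measurableType d) (R : realType).
Variable mu : {measure set T -> \bar R}.
Implicit Types (w X : T -> R).

(** The sign h comes from a Hahn decomposition of the image of w under X, not of
    w itself. It is thus a function of X, as required of the sign of an
    element of the algebra, which must be constant where |x| is. *)
Lemma hahn_sign w X : mu.-integrable setT (EFin \o w) ->
  measurable_fun setT X ->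
  exists h : R -> R, [/\ measurable_fun setT h, forall x, `|h x| = 1 &
    forall A, measurable A -> 0 <= \int[mu]_t (w t * h (X t) * \1_(X @^-1` A) t)].
Proof.
move=> iw mX.
pose c : {charge set T -> \bar R} := induced_charge iw.
pose nu : {charge set R -> \bar R} :=
  measure_function_pushforward__canonical__charge_Charge c mX.
have nuE A : measurable A -> fine (nu A) = \int[mu]_t (w t * \1_(X @^-1` A) t).
  by move=> mA; rewrite -Rintegral_indic.
have [P [N [[mP posP] [mN negN] PNT PN0]]] := Hahn_decomposition nu.
have NE : N = ~` P.
  apply/seteqP; split=> [x Nx Px|x nPx].
    have : (P `&` N) x by split.
    by rewrite PN0.
  by have [] : (P `|` N) x by rewrite PNT.
exists (fun x => 2 * \1_P x - 1); split.
- by apply: measurable_funB => //; apply: measurable_funM.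
- move=> x; rewrite indicE; case: (_ \in _); rewrite ?mulr1 ?mulr0 ?sub0r ?normrN1//.
  by rewrite (_ : 2 - 1 = 1) ?normr1//; ring.
move=> A mA.
have mAP : measurable (A `&` P) by exact: measurableI.
have mAN : measurable (A `&` N) by exact: measurableI.
have i1 := integrable_mul_indic iw (measurable_preimage mX mAP).
have i2 := integrable_mul_indic iw (measurable_preimage mX mAN).
have -> : \int[mu]_t (w t * (2 * \1_P (X t) - 1) * \1_(X @^-1` A) t) =
    fine (nu (A `&` P)) - fine (nu (A `&` N)).
  rewrite !nuE// -RintegralB//; apply: eq_Rintegral => t _.
  rewrite -mulrA -mulrBr; congr (_ * _).
  rewrite NE !indicE /= !in_setI in_setC.
  have pre (B : set R) : (t \in ((fun x => B (X x)) : set T)) = (X t \in B).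
    by apply/idP/idP; rewrite !inE.
  rewrite !pre.
  by case: (X t \in A); case: (X t \in P) => /=; ring.
rewrite subr_ge0 (@le_trans _ _ 0)//.
  by rewrite fine_le0// negN// => x [].
by rewrite fine_ge0// posP// => x [].
Qed.

Lemma cvg_tail_left w X (y : R) : mu.-integrable setT (EFin \o w) ->
  measurable_fun setT X ->
  \int[mu]_(t in X @^-1` `[(y - harmonic n)%R, +oo[) w t @[n --> \oo] -->
  \int[mu]_(t in X @^-1` `[y, +oo[) w t.
Proof.
move=> iw mX; rewrite Rintegral_indic; under eq_cvg do rewrite Rintegral_indic.
apply: (@Rintegral_dominated_cvg _ _ _ _ _ _ (fun t => `|w t|)).
- move=> n; apply: measurable_funM; first exact: measurable_weight iw.
  by apply: measurable_indic; exact: measurable_preimage.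
- move=> t; apply: cvgM; first exact: cvg_cst.
  have [yX|Xy] := leP y (X t).
    apply: cvg_near_cst; apply: nearW => n; rewrite !indicE !mem_set//=.
      by rewrite in_itv/= yX.
    by rewrite in_itv/= andbT (le_trans _ yX)// gerBl harmonic_ge0.
  have Xy0 : 0 < y - X t by rewrite subr_gt0.
  have hX : \forall n \near \oo, harmonic n < y - X t.
    exact: (cvgr_lt 0 (@cvg_harmonic R)).
  apply: cvg_near_cst; near=> n; rewrite !indicE !memNset//=.
    by rewrite in_itv/= andbT; apply/negP; rewrite -ltNge.
  rewrite in_itv/= andbT; apply/negP; rewrite -ltNge ltrBrDl addrC -ltrBrDl.
  by near: n.
- exact: integrable_norm iw.
- by move=> n t; rewrite normrM ler_piMr//; exact: normr_indic_le1.
Unshelve. all: by end_near. Qed.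

(** Q is the generalized inverse of kap y, the mass of {X >= y}: left-continuity
    of kap gives y <= Q u iff u <= kap y, so {Q >= y} meets [0, V] in an
    interval of length kap y. *)
Lemma quantile_exists w X : mu.-integrable setT (EFin \o w) ->
  measurable_fun setT X -> (forall t, 0 <= X t <= 1) ->
  (forall A, measurable A -> 0 <= \int[mu]_(t in X @^-1` A) w t) ->
  exists V : R, exists Q : R -> R, [/\ 0 <= V, nonincreasing_fun Q,
    forall u, 0 <= Q u <= 1, V = \int[mu]_t w t &
    forall y, \int[lebesgue_measure]_(u in Q @^-1` `[y, +oo[) \1_(`[0, V]%classic) u =
      \int[mu]_(t in X @^-1` `[y, +oo[) w t].
Proof.
move=> iw mX X01 pos.
pose kap y := \int[mu]_(t in X @^-1` `[y, +oo[) w t.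
pose V := \int[mu]_t w t.
have V0 : 0 <= V by have := pos setT measurableT; rewrite preimage_setT.
have kap_ni y y' : y <= y' -> kap y' <= kap y.
  move=> yy'; have mD : measurable (`[y, +oo[ `\` `[y', +oo[ : set R).
    exact: measurableD.
  rewrite -subr_ge0 (_ : _ - _ = \int[mu]_(t in X @^-1` (`[y, +oo[ `\` `[y', +oo[)) w t).
    exact: pos.
  rewrite /kap [X in X - _]Rintegral_indic [X in _ - X]Rintegral_indic [RHS]Rintegral_indic.
  rewrite -RintegralB//; last 2 first.
  - by apply: integrable_mul_indic => //; exact: measurable_preimage.
  - by apply: integrable_mul_indic => //; exact: measurable_preimage.
  apply: eq_Rintegral => t _; rewrite -mulrBr; congr (_ * _).
  have E (A : set R) : \1_(X @^-1` A) t = \1_A (X t) :> R by [].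
  rewrite !E !indicE in_setD !mem_setE !in_itv/= !andbT.
  case: (leP y (X t)) => h1; case: (leP y' (X t)) => h2 /=; rewrite ?subrr ?subr0//.
  by have := lt_le_trans h1 (le_trans yy' h2); rewrite ltxx.
have kap_le0 y : y <= 0 -> kap y = V.
  move=> y0; rewrite /kap /V; congr (\int[mu]_(t in _) w t).
  apply/seteqP; split => // t _ /=; rewrite in_itv/= andbT (le_trans y0)//.
  by case/andP: (X01 t).
have kap_gt1 y : 1 < y -> kap y = 0.
  move=> y1; rewrite /kap (_ : X @^-1` _ = set0) ?Rintegral_set0//.
  apply/seteqP; split => // t /=; rewrite in_itv/= andbT leNgt.
  by have /andP[_ /le_lt_trans ->] := X01 t.
(* Adding y = 0 keeps the set nonempty, hence Q monotone, also for u > V. *)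
pose S u := [set y | 0 <= y <= 1 /\ (y = 0 \/ u <= kap y)].
have S0 u : S u 0 by split; [rewrite lexx ler01|left].
have Sub u : ubound (S u) 1 by move=> y [/andP[]].
have Ssup u : has_sup (S u) by split; [exists 0|exists 1].
pose Q u := sup (S u).
have Q01 u : 0 <= Q u <= 1.
  apply/andP; split; first by apply: ub_le_sup; [exists 1|exact: S0].
  by apply: ge_sup; [exists 0|].
have Qni : nonincreasing_fun Q.
  move=> u v uv; apply: sup_le; [|by exists 0|exact: Ssup].
  apply: subset_trans (@le_down R (S u)) => y [y01 h]; split => //.
  by case: h => [|vk]; [left|right; exact: le_trans vk].
have QE u y : 0 < y -> y <= 1 -> (y <= Q u) = (u <= kap y).
  move=> y0 y1; apply/idP/idP => [yQ|uk]; last first.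
    by apply: ub_le_sup; [exists 1|split; [rewrite ltW|right]].
  have ck := cvg_tail_left (y := y) iw mX.
  rewrite /kap -(cvg_lim (@Rhausdorff R) ck); apply: limr_ge.
    by apply/cvg_ex; eexists; exact: ck.
  apply: nearW => n; pose m := Num.max 0 (y - harmonic n).
  have mQ : 0 < Q u - m.
    rewrite subr_gt0 gt_max (lt_le_trans y0 yQ)/= (lt_le_trans _ yQ)//.
    by rewrite gtrBl harmonic_gt0.
  have [z [z01 zk]] := sup_adherent mQ (Ssup u).
  rewrite -/(Q u) opprB addrC subrK /m gt_max => /andP[z0 zy].
  case: zk z0 => [->|uz _]; first by rewrite ltxx.
  by rewrite (le_trans uz)// kap_ni// ltW.
exists V, Q; split => // y.
have lebE (a : R) : 0 <= a -> \int[lebesgue_measure]_u \1_(`[0, a]%classic) u = a.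
  by move=> a0; rewrite Rintegral_indic_itvcc// subr0.
rewrite Rintegral_indic -/(kap y).
have E (A : set R) u : \1_(Q @^-1` A) u = \1_A (Q u) :> R by [].
have [y0|y0] := leP y 0.
  rewrite kap_le0// -[RHS]lebE//; apply: eq_Rintegral => u _.
  rewrite E [X in _ * X]indicE mem_set ?mulr1//= in_itv/= andbT (le_trans y0)//.
  by case/andP: (Q01 u).
have [y1|y1] := leP y 1; last first.
  rewrite kap_gt1//; under eq_Rintegral => u _.
    rewrite E [X in _ * X]indicE memNset ?mulr0; last first.
      rewrite /= in_itv/= andbT; apply/negP; rewrite -ltNge.
      by case/andP: (Q01 u) => _ /le_lt_trans; apply.
    over.
  by rewrite Rintegral_cst// mul0r.
have kV : kap y <= V by rewrite -(kap_le0 0) ?lexx// kap_ni// ltW.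
rewrite -[RHS]lebE; last exact: pos.
apply: eq_Rintegral => u _; rewrite E !indicE !mem_setE !in_itv/= andbT QE//.
case: (0 <= u) => /=; last by rewrite mul0r.
by case: (leP u (kap y)) => [uk|_]; rewrite ?mulr0// (le_trans uk kV) mul1r.
Qed.

End laplace_representation.

(** * The algebra as a class of Laplace transforms *)

(** For f(z) = int exp (- xi z) dmu(xi), decay at rate a means that mu lives on
    xi >= - ln a. *)
Definition decays (R : realType) (f : {posnum R} -> R) (a : R) :=
  exists C, forall z, `|f z| <= C * a `^ z%:num.

Section laplace_class.
Context (R : realType).
Implicit Types (z : {posnum R}).

Lemma powR_itv01 (x : R) z : 0 <= x <= 1 -> 0 <= x `^ z%:num <= 1.
Proof.
move=> /andP[x0 x1]; rewrite powR_ge0/=.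
have <- : 1 `^ z%:num = 1 :> R by rewrite powR1.
by rewrite ge0_ler_powR// nnegrE.
Qed.

Lemma spow_sign_mul (e y : R) z : `|e| = 1 -> 0 <= y ->
  spow (e * y) z = e * y `^ z%:num.
Proof.
move=> e1 y0; rewrite /spow normrM e1 mul1r (ger0_norm y0).
have [->|yn0] := eqVneq y 0.
  by rewrite mulr0 sgr0 mul0r powR0 ?mulr0// gt_eqF.
have yp : 0 < y by rewrite lt_def yn0.
by rewrite sgrM (gtr0_sg yp) mulr1 [in RHS](numEsg e) e1 mulr1.
Qed.

(** Take x_u = h(Q u) Q u with Q the quantile function of the positive
    distribution h(X) w; its sign is a function of its absolute value. *)
Lemma Bbp_laplace d (T : measurableType d) (mu : {measure set T -> \bar R})
    (w X : T -> R) (f : {posnum R} -> R) :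
  mu.-integrable setT (EFin \o w) -> measurable_fun setT X ->
  (forall t, 0 <= X t <= 1) ->
  (forall z, f z = \int[mu]_t (w t * X t `^ z%:num)) -> Bbp f.
Proof.
move=> iw mX X01 fE.
have [h [mh h1 hpos]] := hahn_sign iw mX.
have iwh : mu.-integrable setT (EFin \o (fun t => w t * h (X t))).
  apply: (@integrable_mul_bounded _ _ _ _ _ _ 1) => //.
    exact: measurableT_comp.
  by move=> t; rewrite h1.
have [|V [Q [V0 Qni Q01 VE QE]]] := quantile_exists iwh mX X01.
  by move=> A mA; rewrite Rintegral_indic hpos.
have mQ : measurable_fun setT Q by exact: nonincreasing_measurable.
pose x u := h (Q u) * Q u.
have nx u : `|x u| = Q u.
  by rewrite normrM h1 mul1r ger0_norm//; case/andP: (Q01 u).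
exists V, x; split => //.
- apply: measurable_funS (measurableT) _ _ => //.
  by apply: measurable_funM => //; exact: measurableT_comp.
- by move=> u _; rewrite -ler_norml nx; case/andP: (Q01 u).
- move=> u v _ _ uv; rewrite /smile_left !nx; split; first exact: Qni.
  by rewrite /x => ->.
move=> z; pose phi y := \1_(`[0, 1]%classic) y * (h y * y `^ z%:num).
have phiE y : 0 <= y <= 1 -> phi y = h y * y `^ z%:num.
  by move=> y01; rewrite /phi indicE mem_set ?mul1r//= in_itv.
have mphi : measurable_fun setT phi.
  apply: measurable_funM; first exact: measurable_indic.
  by apply: measurable_funM => //; exact: measurable_powR.
have phi1 y : `|phi y| <= 1.
  rewrite /phi indicE; case: (boolP (y \in _)) => [|_]; last by rewrite mul0r normr0.
  rewrite inE /= in_itv/= => y01; rewrite mul1r normrM h1 mul1r.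
  by have /andP[p0 p1] := powR_itv01 z y01; rewrite ger0_norm.
rewrite fE [RHS]Rintegral_mkcond.
transitivity (\int[lebesgue_measure]_u (\1_(`[0, V]%classic) u * phi (Q u))).
  2: { apply: eq_Rintegral => u _; rewrite patch_indic/= mulrC phiE//.
       by rewrite /x spow_sign_mul//; case/andP: (Q01 u). }
rewrite -(@Rintegral_transfer _ T _ _ R mu lebesgue_measure
  (fun t => w t * h (X t)) X (\1_(`[0, V]%classic)) Q iwh _ mX mQ _ _ phi 1)//.
- apply: eq_Rintegral => t _; rewrite phiE// mulrA; congr (_ * _).
  by rewrite -mulrA -expr2 -real_normK ?num_real// h1 expr1n mulr1.
- exact: integrable_indic_itv.
- by rewrite -VE Rintegral_indic_itvcc// subr0.
Qed.

Section restricted_weight.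
Variables (D : set R) (x : R -> R).
Hypotheses (mD : measurable D) (mx : measurable_fun D x).
Hypothesis x1 : forall u, D u -> -1 <= x u <= 1.

Lemma measurable_patch : measurable_fun setT (x \_ D).
Proof. exact/(measurable_restrictT _ mD). Qed.

Lemma normr_patch01 u : 0 <= `|(x \_ D) u| <= 1.
Proof.
rewrite normr_ge0/= patchE; case: ifPn => [|_]; last by rewrite normr0.
by rewrite inE => /x1; rewrite ler_norml.
Qed.
End restricted_weight.

Lemma measurable_sgr : measurable_fun setT (@Num.sg R).
Proof.
rewrite (_ : Num.sg = (fun x : R => \1_(`]0, +oo[%classic) x - \1_(`]-oo, 0[%classic) x)).
  by apply: measurable_funB; exact: measurable_indic.
apply/funext => x; rewrite !indicE !mem_setE !in_itv/= andbT.
case: (ltrgt0P x) => [x0|x0|->]; rewrite ?ltxx ?subrr ?sgr0//.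
  by rewrite (gtr0_sg x0) subr0.
by rewrite (ltr0_sg x0) sub0r.
Qed.

Lemma normr_sg_le1 (x : R) : `|Num.sg x| <= 1.
Proof. by rewrite normr_sg; case: (x != 0). Qed.

Lemma Bbp_laplaceP (f : {posnum R} -> R) : Bbp f ->
  exists w X : R -> R, [/\ lebesgue_measure.-integrable setT (EFin \o w),
    measurable_fun setT X, forall t, 0 <= X t <= 1 &
    forall z, f z = \int[lebesgue_measure]_t (w t * X t `^ z%:num)].
Proof.
move=> [V [x [V0 mx x1 _ fE]]].
pose x' := x \_ `[0, V]; have mx' : measurable_fun setT x' by exact: measurable_patch.
exists (fun t => \1_(`[0, V]%classic) t * Num.sg (x' t)), (fun t => `|x' t|); split.
- apply: (@integrable_mul_bounded _ _ _ _ _ _ 1) => //.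
  + exact: integrable_indic_itv.
  + by apply: measurableT_comp => //; exact: measurable_sgr.
  + by move=> t; exact: normr_sg_le1.
- exact: measurableT_comp.
- by move=> t; apply: normr_patch01 => u ?; apply: x1; rewrite inE.
move=> z; rewrite fE Rintegral_mkcond; apply: eq_Rintegral => t _.
rewrite patch_indic/= /spow /x' patch_indic/= indicE.
by case: (t \in _); rewrite ?mulr1 ?mulr0 ?mul1r ?mul0r.
Qed.

End laplace_class.

(** * Rates of decay of products *)

Section decay.
Context (R : realType).
Implicit Types (f g : {posnum R} -> R) (z : {posnum R}).

Definition posnum_of (n : nat) : {posnum R} := PosNum (ltr0Sn R n).

Lemma powR_posnum_of (x : R) n : 0 <= x -> x `^ (posnum_of n)%:num = x ^+ n.+1.
Proof. exact: powR_mulrn. Qed.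

Section representation.
Context d (T : measurableType d) (mu : {measure set T -> \bar R}).
Variables (w X : T -> R) (f : {posnum R} -> R).
Hypotheses (iw : mu.-integrable setT (EFin \o w)) (mX : measurable_fun setT X).
Hypothesis X01 : forall t, 0 <= X t <= 1.
Hypothesis fE : forall z, f z = \int[mu]_t (w t * X t `^ z%:num).

Lemma laplace_exprE n : f (posnum_of n) = \int[mu]_t (w t * X t ^+ n.+1).
Proof.
rewrite fE; apply: eq_Rintegral => t _; rewrite powR_posnum_of//.
by case/andP: (X01 t).
Qed.

Lemma decays_tail_eq0 a y : 0 <= a < y -> decays f a ->
  \int[mu]_(t in X @^-1` `[y, +oo[) w t = 0.
Proof.
move=> /andP[a0 ay] [C fC]; apply: (growth_tail_eq0 (a := a) (C := C) iw mX X01).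
  by rewrite a0.
by move=> n; rewrite -laplace_exprE -powR_posnum_of.
Qed.

Lemma tail_eq0_decays a : 0 <= a ->
  (forall y, a < y -> \int[mu]_(t in X @^-1` `[y, +oo[) w t = 0) -> decays f a.
Proof.
move=> a0 tail0; exists (\int[mu]_t `|w t|) => z; rewrite fE mulrC.
pose phi y := \1_(`[0, 1]%classic) y * y `^ z%:num.
have phiE y : 0 <= y <= 1 -> phi y = y `^ z%:num.
  by move=> y01; rewrite /phi indicE mem_set ?mul1r//= in_itv.
have mphi : measurable_fun setT phi.
  by apply: measurable_funM; [exact: measurable_indic|exact: measurable_powR].
have phiN y : ~ (0 <= y <= 1) -> phi y = 0.
  by move=> y01; rewrite /phi indicE memNset ?mul0r//= in_itv.
have -> : \int[mu]_t (w t * X t `^ z%:num) = \int[mu]_t (w t * phi (X t)).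
  by apply: eq_Rintegral => t _; rewrite phiE.
apply: (@tail_normr_Rintegral_le _ _ _ _ _ _ a 1) => //.
- by move=> t; case/andP: (X01 t).
- exact: powR_ge0.
- move=> y; have [y01|/negP/phiN->] := boolP (0 <= y <= 1); last by rewrite normr0.
  by rewrite phiE// ger0_norm ?powR_ge0//; case/andP: (powR_itv01 z y01).
- move=> y /andP[y0 ya]; have [y01|/negP/phiN->] := boolP (0 <= y <= 1).
    by rewrite phiE// ger0_norm ?powR_ge0// ge0_ler_powR// nnegrE.
  by rewrite normr0 powR_ge0.
Qed.

End representation.

Lemma Bbp_mul f g : Bbp f -> Bbp g -> Bbp (f \* g).
Proof.
move=> /Bbp_laplaceP[w1 [X1 [iw1 mX1 X1b fE]]] /Bbp_laplaceP[w2 [X2 [iw2 mX2 X2b gE]]].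
have powX (X : R -> R) (w : R -> R) z : lebesgue_measure.-integrable setT (EFin \o w) ->
    measurable_fun setT X -> (forall t, 0 <= X t <= 1) ->
    lebesgue_measure.-integrable setT (EFin \o (fun t => w t * X t `^ z%:num)).
  move=> iw mX X01; apply: (@integrable_mul_bounded _ _ _ _ _ _ 1) => //.
    by apply: (measurableT_comp (measurable_powR _)).
  by move=> t; rewrite ger0_norm ?powR_ge0//; case/andP: (powR_itv01 z (X01 t)).
apply: (@Bbp_laplace _ _ _ (lebesgue_measure \x lebesgue_measure)%E
  (fun p => w1 p.1 * w2 p.2) (fun p => X1 p.1 * X2 p.2)).
- exact: integrable_prod.
- apply: measurable_funM.
    by apply: measurableT_comp => //; exact: measurable_fst.
  by apply: measurableT_comp => //; exact: measurable_snd.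
- move=> t; have /andP[h1 h2] := X1b t.1; have /andP[h3 h4] := X2b t.2.
  by rewrite mulr_ge0// mulr_ile1.
move=> z; rewrite /= fE gE -Rintegral_prod; [|exact: powX|exact: powX].
apply: eq_Rintegral => t _; rewrite powRM; first by rewrite mulrACA.
  by case/andP: (X1b t.1).
by case/andP: (X2b t.2).
Qed.

(** Titchmarsh's theorem for rates of decay. If c < r1 r2, pick a1 < r1 and
    a2 < r2 with a1 a2 = c; f does not decay at rate a1, so w1 charges some
    tail {X1 >= s} with s > a1, and likewise for g. As s t > c, this
    contradicts [titchmarsh_tails], once the parts of f and g carried by
    {X < c} are removed: they are O(c^z). *)
Lemma decays_mul_ge f g (r1 r2 c : R) : Bbp f -> Bbp g ->
  0 < r1 <= 1 -> 0 < r2 <= 1 ->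
  (forall a, 0 < a -> decays f a -> r1 <= a) ->
  (forall a, 0 < a -> decays g a -> r2 <= a) ->
  0 < c -> decays (f \* g) c -> r1 * r2 <= c.
Proof.
move=> /Bbp_laplaceP[w1 [X1 [iw1 mX1 X1b fE]]] /Bbp_laplaceP[w2 [X2 [iw2 mX2 X2b gE]]].
move=> /andP[r10 r11] /andP[r20 r21] fr1 gr2 c0 [C fgC].
rewrite leNgt; apply/negP => cr.
have [a1 [a1r a1c a10]] : exists a1, [/\ a1 < r1, c / r2 < a1 & 0 < a1].
  exists ((c / r2 + r1) / 2).
  have h : c / r2 < r1 by rewrite ltr_pdivrMr.
  have h' : 0 < c / r2 by rewrite divr_gt0.
  by split; lra.
pose a2 := c / a1.
have a20 : 0 < a2 by rewrite divr_gt0.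
have a2r : a2 < r2 by rewrite ltr_pdivrMr// mulrC -ltr_pdivrMr.
have a12 : a1 * a2 = c by rewrite mulrC divfK// gt_eqF.
have ca1 : c <= a1 by rewrite -a12 ler_piMr// ltW// (lt_le_trans a2r).
have ca2 : c <= a2 by rewrite -a12 ler_piMl// ltW// (lt_le_trans a1r).
have c1 : c <= 1 by rewrite (le_trans ca1)// ltW// (lt_le_trans a1r).
have tail_ex (w X : R -> R) (h : {posnum R} -> R) (a r : R) :
    lebesgue_measure.-integrable setT (EFin \o w) -> measurable_fun setT X ->
    (forall t, 0 <= X t <= 1) ->
    (forall z, h z = \int[lebesgue_measure]_t (w t * X t `^ z%:num)) ->
    0 < a < r -> (forall b, 0 < b -> decays h b -> r <= b) ->
    exists2 s, a < s & \int[lebesgue_measure]_(t in X @^-1` `[s, +oo[) w t <> 0.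
  move=> iw mX X01 hE /andP[a0 ar] hr; apply: contrapT => nex.
  have : decays h a.
    apply: (tail_eq0_decays iw mX X01 hE (ltW a0)) => y ay.
    by apply: contrapT => Hy; apply: nex; exists y.
  by move=> /(hr _ a0); rewrite leNgt ar.
have [|s a1s Hs] := tail_ex _ _ _ a1 r1 iw1 mX1 X1b fE _ fr1; first by rewrite a10.
have [|t a2t Ht] := tail_ex _ _ _ a2 r2 iw2 mX2 X2b gE _ gr2; first by rewrite a20.
have cst : c < s * t.
  by rewrite -a12 ltr_pM// ltW.
(* Truncation at c; taking the maximum with c leaves a variable in [c, 1] also
   where the weight vanishes. *)
pose tw (w X : R -> R) u := w u * \1_(X @^-1` `[c, +oo[) u.
pose tX (X : R -> R) u := Num.max c (X u).
have itw (w X : R -> R) : lebesgue_measure.-integrable setT (EFin \o w) ->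
    measurable_fun setT X -> lebesgue_measure.-integrable setT (EFin \o tw w X).
  by move=> iw mX; apply: integrable_mul_indic => //; exact: measurable_preimage.
have mtX (X : R -> R) : measurable_fun setT X -> measurable_fun setT (tX X).
  by move=> mX; exact: measurable_maxr.
have tXb (X : R -> R) : (forall u, 0 <= X u <= 1) -> forall u, c <= tX X u <= 1.
  by move=> Xb u; rewrite /tX le_max lexx/= ge_max c1; case/andP: (Xb u).
have tail_tw (w X : R -> R) y : c < y ->
    \int[lebesgue_measure]_(u in tX X @^-1` `[y, +oo[) tw w X u =
    \int[lebesgue_measure]_(u in X @^-1` `[y, +oo[) w u.
  move=> cy; rewrite [LHS]Rintegral_indic [RHS]Rintegral_indic.
  apply: eq_Rintegral => u _; rewrite /tw -mulrA; congr (_ * _).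
  rewrite mul_indic; congr (\1_ _ u); apply/seteqP; split => v; rewrite /= !in_itv/= !andbT.
    by rewrite /tX le_max => -[_ /orP[|//]]; rewrite leNgt cy.
  by move=> yX; rewrite /tX le_max yX orbT; split=> //; rewrite (le_trans (ltW cy)).
have trunc (w X : R -> R) (h : {posnum R} -> R) :
    lebesgue_measure.-integrable setT (EFin \o w) -> measurable_fun setT X ->
    (forall u, 0 <= X u <= 1) ->
    (forall z, h z = \int[lebesgue_measure]_u (w u * X u `^ z%:num)) ->
    exists E, forall n,
     `|\int[lebesgue_measure]_u (tw w X u * tX X u ^+ n.+1)| <= E /\
     `|h (posnum_of n) - \int[lebesgue_measure]_u (tw w X u * tX X u ^+ n.+1)| <=
       E * c ^+ n.+1 /\ `|h (posnum_of n)| <= E.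
  move=> iw mX X01 hE; exists (\int[lebesgue_measure]_u `|w u|) => n.
  have mA : measurable (X @^-1` `[c, +oo[) by exact: measurable_preimage.
  have mXn : measurable_fun setT (fun u => X u ^+ n.+1) by exact: measurable_funX.
  have Xn u : 0 <= X u ^+ n.+1 <= 1.
    by have /andP[x0 x1] := X01 u; rewrite exprn_ge0// exprn_ile1.
  have nXn u : `|X u ^+ n.+1| <= 1 by case/andP: (Xn u) => h0 h1; rewrite ger0_norm.
  have mAX : measurable_fun setT (fun u => \1_(X @^-1` `[c, +oo[) u * X u ^+ n.+1).
    by apply: measurable_funM => //; exact: measurable_indic.
  have nAX u : `|\1_(X @^-1` `[c, +oo[) u * X u ^+ n.+1| <= 1.
    by rewrite normrM mulr_ile1//; exact: normr_indic_le1.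
  have -> : \int[lebesgue_measure]_u (tw w X u * tX X u ^+ n.+1) =
      \int[lebesgue_measure]_u (w u * (\1_(X @^-1` `[c, +oo[) u * X u ^+ n.+1)).
    apply: eq_Rintegral => u _; rewrite /tw -mulrA; congr (_ * _).
    rewrite indicE; case: (boolP (u \in _)) => [|_]; last by rewrite !mul0r.
    rewrite inE /= in_itv/= andbT => cX; rewrite /tX.
    by congr (_ * _ ^+ _); apply/max_idPr.
  rewrite (laplace_exprE (mu := lebesgue_measure) X01 hE); split; [|split].
  - by rewrite -[leRHS]mul1r; exact: normr_Rintegral_mul_le.
  - rewrite -RintegralB//; last 2 first.
    + exact: (integrable_mul_bounded iw mXn nXn).
    + exact: (integrable_mul_bounded iw mAX nAX).
    under eq_Rintegral do rewrite -mulrBr.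
    rewrite mulrC; apply: normr_Rintegral_mul_le => //.
      exact: measurable_funB.
    move=> u; rewrite indicE; case: (boolP (u \in _)) => [_|].
      by rewrite mul1r subrr normr0 exprn_ge0// ltW.
    rewrite notin_setE /= in_itv/= andbT => /negP; rewrite -ltNge => Xc.
    have /andP[x0 x1] := X01 u.
    by rewrite mul0r subr0 ger0_norm ?exprn_ge0// lerXn2r ?nnegrE// ltW.
  - by rewrite -[leRHS]mul1r; exact: normr_Rintegral_mul_le.
have [E1 f1] := trunc _ _ _ iw1 mX1 X1b fE.
have [E2 g1] := trunc _ _ _ iw2 mX2 X2b gE.
have c01 : 0 < c <= 1 by rewrite c0.
pose fk k := \int[lebesgue_measure]_u (tw w1 X1 u * tX X1 u ^+ k).
pose gk k := \int[lebesgue_measure]_u (tw w2 X2 u * tX X2 u ^+ k).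
have dom : geom_dominated (fun k => fk k * gk k) c.
  have C0 : 0 <= C.
    have := le_trans (normr_ge0 _) (fgC (posnum_of 0)).
    by rewrite pmulr_lge0// powR_gt0.
  have E10 : 0 <= E1 by have [/(le_trans (normr_ge0 _))] := f1 0%N.
  have E20 : 0 <= E2 by have [/(le_trans (normr_ge0 _))] := g1 0%N.
  have E0 : 0 <= C + E1 * E2 + E1 * E2 by rewrite !addr_ge0// mulr_ge0.
  exists (`|fk 0%N * gk 0%N| + (C + E1 * E2 + E1 * E2)) => -[|n].
    by rewrite expr0 mulr1 lerDl.
  have cn0 : 0 <= c ^+ n.+1 by rewrite exprn_ge0// ltW.
  apply: (@le_trans _ _ ((C + E1 * E2 + E1 * E2) * c ^+ n.+1)); last first.
    by rewrite ler_wpM2r// lerDr.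
  have [fkE [fd fn]] := f1 n; have [gkE [gd _]] := g1 n.
  pose p := posnum_of n; rewrite -/p in fd fn gd.
  have -> : fk n.+1 * gk n.+1 =
      f p * g p - f p * (g p - gk n.+1) - (f p - fk n.+1) * gk n.+1 by ring.
  rewrite [leRHS]mulrDl [X in _ <= X + _]mulrDl.
  apply: (le_trans (ler_normB _ _)); apply: lerD.
    apply: (le_trans (ler_normB _ _)); apply: lerD.
      by have := fgC p; rewrite powR_posnum_of// ltW.
    by rewrite normrM -mulrA ler_pM.
  by rewrite normrM mulrAC ler_pM.
have s0 : 0 < s by rewrite (lt_trans _ a1s).
have t0 : 0 < t by rewrite (lt_trans _ a2t).
have := titchmarsh_tails (itw _ _ iw1 mX1) (itw _ _ iw2 mX2) (mtX _ mX1) (mtX _ mX2)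
  c0 (tXb _ X1b) (tXb _ X2b) c01 dom s0 t0 cst.
rewrite !tail_tw ?(le_lt_trans ca1 a1s) ?(le_lt_trans ca2 a2t)// => /eqP.
by rewrite mulf_eq0 => /orP[] /eqP.
Qed.

End decay.

(** * Existence of the canonical form *)

Section exponential_weight.
Context (R : realType).
Implicit Types (s y : R).
Local Notation mu := (@lebesgue_measure R).

Lemma integral_expRN_itvcy (a : R) :
  (\int[mu]_(t in `[a, +oo[) (expR (- t))%:E = (expR (- a))%:E)%E.
Proof.
have cE : continuous (fun z : R^o => expR (- z)).
  by move=> z; apply: continuous_comp; [exact: continuousN|exact: continuous_expR].
rewrite (@ge0_continuous_FTC2y _ _ (fun t => - expR (- t)) _ 0)//.
- by rewrite EFinN oppeK add0e.
- exact: continuous_subspaceT.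
- by rewrite -oppr0; apply: cvgN; exact: cvgr_expR.
- by apply: cvgN; apply/cvg_at_right_filter; exact: cE.
- move=> z _; rewrite derive1_comp// derive1N// derive1_id mulN1r derive1_comp// derive1E.
  have /funeqP -> := @derive_expR R.
  by rewrite derive1N// derive1_id mulrN1 opprK.
Qed.

Definition exp_weight s t : R := expR (- t) * \1_(`]s, +oo[%classic) t.

Lemma exp_weight_ge0 s t : 0 <= exp_weight s t.
Proof. by rewrite mulr_ge0// expR_ge0. Qed.

Lemma integrable_expRN_itvcy (a : R) :
  mu.-integrable `[a, +oo[ (EFin \o (fun t => expR (- t))).
Proof.
apply/integrableP; split.
  apply/measurable_EFinP; apply: measurable_funS (measurableT) _ _ => //.
  by apply: measurableT_comp => //; exact: measurable_expR.
under eq_integral do rewrite /= ger0_norm ?expR_ge0//.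
by rewrite integral_expRN_itvcy ltry.
Qed.

Lemma integrable_exp_weight s : mu.-integrable setT (EFin \o exp_weight s).
Proof.
have h : mu.-integrable `]s, +oo[ (EFin \o (fun t => expR (- t))).
  apply: (integrableS _ _ _ (integrable_expRN_itvcy s)) => //.
  by apply: subset_itvr; rewrite bnd_simp.
have : mu.-integrable setT ((EFin \o (fun t => expR (- t))) \_ `]s, +oo[).
  exact: ((@integrable_mkcond _ _ _ mu _ _ (measurable_itv _)).1 h).
by apply: eq_integrable => // t _; rewrite restrict_EFin patch_indic.
Qed.

Lemma Rintegral_exp_weight_tail s y :
  \int[mu]_(t in `[y, +oo[) exp_weight s t = expR (- Num.max s y).
Proof.
rewrite [LHS]Rintegral_indic; have [sy|ys] := ltP s y.
  transitivity (\int[mu]_(t in `[y, +oo[) expR (- t)).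
    rewrite [RHS]Rintegral_indic; apply: eq_Rintegral => t _.
    rewrite /exp_weight -mulrA mul_indic; congr (_ * \1_ _ _).
    apply/seteqP; split => u /=; first by case.
    by rewrite !in_itv/= !andbT => yu; split=> //; exact: lt_le_trans yu.
  by rewrite /Rintegral integral_expRN_itvcy.
transitivity (\int[mu]_(t in `]s, +oo[) expR (- t)).
  rewrite [RHS]Rintegral_indic; apply: eq_Rintegral => t _.
  rewrite /exp_weight -mulrA mul_indic; congr (_ * \1_ _ _).
  apply/seteqP; split => u /=; first by case.
  by rewrite !in_itv/= !andbT => su; split=> //; rewrite (le_trans ys)// ltW.
rewrite Rintegral_itv_obnd_cbnd.
  by rewrite /Rintegral integral_expRN_itvcy.
apply: (integrableS _ _ _ (integrable_expRN_itvcy s)) => //.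
by apply: subset_itvr; rewrite bnd_simp.
Qed.

Lemma Rintegral_exp_weight s : \int[mu]_t exp_weight s t = expR (- s).
Proof.
rewrite -[in RHS](@max_l _ _ s s)// -Rintegral_exp_weight_tail [RHS]Rintegral_indic.
apply: eq_Rintegral => t _; rewrite /exp_weight -mulrA mul_indic.
congr (_ * \1_ _ _); apply/seteqP; split => u /=; last by case.
by rewrite !in_itv/= !andbT => su; split => //; exact: ltW.
Qed.

End exponential_weight.

Section canonical_existence.
Context (R : realType).

(** With W the end of the support of x, the image of exp (- s) ds under
    u = W - exp (- s) is Lebesgue measure on [0, W]; on tails this is a direct
    computation. *)
Lemma canonical_form_exists (f : {posnum R} -> R) : Bbp_nonzero f ->
  exists s0 : R, exists x : R -> R, canonical_form f s0 x.
Proof.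
move=> [[V [x [V0 mx x1 sx fE]]] fn0].
(* Including u = 0 makes W = 0 when x vanishes on ]0, V]. *)
pose D := [set u | 0 <= u <= V /\ (u = 0 \/ x u != 0)].
have D0 : D 0 by split; [rewrite lexx|left].
have Dsup : has_sup D by split; [exists 0|exists V => u [/andP[]]].
pose W := sup D.
have W0 : 0 <= W by apply: ub_le_sup => //; case: Dsup.
have WV : W <= V by apply: ge_sup; [exists 0|move=> u [/andP[]]].
pose x' := x \_ `[0, V].
have mx' : measurable_fun setT x' by exact: measurable_patch.
have x'1 u : -1 <= x' u <= 1.
  by rewrite -ler_norml; case/andP: (normr_patch01 x1 u).
have x'E u : 0 <= u <= V -> x' u = x u.
  by move=> u01; rewrite /x' patchE mem_set//= in_itv.
have x'W u : W < u -> x' u = 0.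
  move=> Wu; rewrite /x' patchE; case: ifPn => // ; rewrite inE/= in_itv/= => uV.
  apply: contrapT => /eqP xu; move: Wu; rewrite ltNge => /negP; apply.
  by apply: ub_le_sup; [case: Dsup|split=> //; right].
have x'n0 u : 0 < u -> u < W -> x' u != 0.
  move=> u0 uW; have Wu0 : 0 < W - u by rewrite subr_gt0.
  have [v [v0V vx] uv] := sup_adherent Wu0 Dsup.
  rewrite -/W opprB addrC subrK in uv.
  case: vx => [v0|xv]; first by move: (lt_trans u0 uv); rewrite v0 ltxx.
  have /andP[v00 vV] := v0V.
  have u01 : 0 <= u <= V by rewrite (ltW u0) (le_trans (ltW uv)).
  rewrite x'E// -normr_gt0 (@lt_le_trans _ _ `|x v|) ?normr_gt0//.
  by have [] := sx u v _ _ (ltW uv); rewrite ?in_itv.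
have fW z : f z = \int[lebesgue_measure]_u (\1_(`[0, W]%classic) u * spow (x' u) z).
  rewrite fE [LHS]Rintegral_mkcond; apply: eq_Rintegral => u _.
  rewrite patch_indic/= mulrC !indicE.
  have [uW|Wu] := leP u W; last first.
    have -> : spow (x' u) z = 0 by rewrite x'W// /spow sgr0 mul0r.
    rewrite mulr0; case: (boolP (u \in _)) => [|_]; last by rewrite mul0r.
    rewrite inE /= in_itv/= => uV; rewrite -x'E// x'W//.
    by rewrite /spow sgr0 mul0r mulr0.
  rewrite !mem_setE !in_itv/= uW andbT (le_trans uW WV) andbT.
  have [u0|u0] := leP 0 u; last by rewrite !mul0r.
  by rewrite x'E// u0 (le_trans uW).
have Wgt0 : 0 < W.
  rewrite lt_def W0 andbT; apply/eqP => W00; apply: fn0; apply/funext => z.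
  rewrite fW W00; transitivity (\int[lebesgue_measure]_(u in [set 0 : R]) spow (x' u) z).
    rewrite [RHS]Rintegral_indic set_itv1.
    by apply: eq_Rintegral => u _; rewrite mulrC.
  by rewrite Rintegral_set1.
pose s0 := - ln W.
have es0 : expR (- s0) = W by rewrite /s0 opprK lnK.
have eW t : s0 < t -> expR (- t) < W by rewrite -es0 ltr_expR ltrN2.
exists s0, (fun s => x' (W - expR (- s))); split.
- apply: measurable_funS (measurableT) _ _ => //.
  apply: measurableT_comp => //; apply: measurable_funB => //.
  by apply: measurableT_comp => //; exact: measurable_expR.
- move=> s ss; split; first exact: x'1.
  by apply: x'n0; [rewrite subr_gt0 eW|rewrite gtrBl expR_gt0].
- move=> s t ss st; have es := eW _ ss.
  have et : expR (- t) <= expR (- s) by rewrite ler_expR lerN2.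
  have ps := expR_gt0 (- t).
  have us : 0 <= W - expR (- s) <= V.
    by rewrite subr_ge0 (ltW es)/= (le_trans _ WV)// gerBl expR_ge0.
  have ut : 0 <= W - expR (- t) <= V.
    by rewrite subr_ge0 (le_trans et (ltW es))/= (le_trans _ WV)// gerBl expR_ge0.
  by rewrite !x'E//; apply: sx; rewrite ?in_itv// lerB.
move=> z; rewrite fW.
have mphi : measurable_fun setT (fun u => spow (x' u) z).
  apply: measurable_funM.
    by apply: measurableT_comp => //; exact: measurable_sgr.
  apply: (measurableT_comp (measurable_powR _)); exact: measurableT_comp.
have phi1 u : `|spow (x' u) z| <= 1.
  rewrite normrM mulr_ile1 ?normr_sg_le1// ger0_norm ?powR_ge0//.
  have x01 : 0 <= `|x' u| <= 1 by rewrite normr_ge0 ler_norml x'1.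
  by case/andP: (powR_itv01 z x01).
rewrite (@Rintegral_transfer _ _ _ _ R lebesgue_measure lebesgue_measure
  (\1_(`[0, W]%classic)) id (exp_weight s0) (fun t => W - expR (- t))
  _ _ _ _ _ _ _ 1 mphi phi1).
- rewrite [RHS]Rintegral_mkcond; apply: eq_Rintegral => t _.
  by rewrite patch_indic/= /exp_weight [LHS]mulrC mulrA.
- exact: integrable_indic_itv.
- exact: integrable_exp_weight.
- exact: measurable_id.
- apply: measurable_funB => //.
  by apply: measurableT_comp => //; exact: measurable_expR.
- by rewrite Rintegral_indic_itvcc// subr0 Rintegral_exp_weight.
move=> y.
rewrite [LHS]Rintegral_indic.
transitivity (\int[lebesgue_measure]_u \1_(`[Num.max 0 y, W]%classic) u).
  apply: eq_Rintegral => u _; rewrite mul_indic; congr (\1_ _ u).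
  apply/seteqP; split => v; rewrite /= !in_itv/= !andbT ge_max.
    by move=> [/andP[-> ->] ->].
  by move=> /andP[/andP[-> ->] ->].
have [Wy|yW] := leP W y.
  rewrite [RHS](_ : _ = 0); last first.
    rewrite (_ : _ @^-1` _ = set0) ?Rintegral_set0//.
    apply/seteqP; split => // t /=; rewrite in_itv/= andbT leNgt.
    by rewrite (lt_le_trans _ Wy)// gtrBl expR_gt0.
  rewrite max_r ?(le_trans W0 Wy)//; move: Wy; rewrite le_eqVlt => /predU1P[->|Wy].
    by rewrite Rintegral_indic_itvcc// subrr.
  by rewrite set_itv_ge ?bnd_simp -?ltNge// indic0 Rintegral_cst// mul0r.
have Wy0 : 0 < W - y by rewrite subr_gt0.
rewrite Rintegral_indic_itvcc; last by rewrite ge_max W0 ltW.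
have -> : (fun t : R => W - expR (- t)) @^-1` `[y, +oo[ = `[- ln (W - y), +oo[%classic.
  apply/seteqP; split => t; rewrite /= !in_itv/= !andbT lerBrDr -lerBrDl.
    by rewrite -{1}(lnK Wy0) ler_expR lerNl.
  by rewrite -{2}(lnK Wy0) ler_expR lerNl.
rewrite Rintegral_exp_weight_tail; have [y0|y0] := leP y 0.
  by rewrite subr0 max_l ?es0// lerN2 ler_ln ?posrE// lerBrDr gerDl.
by rewrite max_r ?opprK ?lnK// lerN2 ler_ln ?posrE// gerBl ltW.
Qed.
End canonical_existence.

(** * The canonical form and the rate of decay *)

Section canonical_rate.
Context (R : realType).
Local Notation mu := (@lebesgue_measure R).
Variables (f : {posnum R} -> R) (s0 : R) (x : R -> R).
Hypothesis cf : canonical_form f s0 x.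

Let mx : measurable_fun `]s0, +oo[ x. Proof. by case: cf. Qed.
Let x1 s : s0 < s -> -1 <= x s <= 1. Proof. by move=> ss; case: cf => _ /(_ _ ss)[]. Qed.
Let xn0 s : s0 < s -> x s != 0. Proof. by move=> ss; case: cf => _ /(_ _ ss)[]. Qed.
Let sx s t : s0 < s -> s <= t -> smile_left (x s) (x t).
Proof. by case: cf => _ _ + _; apply. Qed.
Let fE z : f z = \int[mu]_(s in `]s0, +oo[) (spow (x s) z * expR (- s)).
Proof. by case: cf. Qed.

Let x' := x \_ `]s0, +oo[.
Let X t := `|x' t|.
Let w t := exp_weight s0 t * Num.sg (x' t).

Let x'E t : s0 < t -> x' t = x t.
Proof. by move=> st; rewrite /x' patchE mem_set//= in_itv/= st. Qed.

Let x'0 t : t <= s0 -> x' t = 0.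
Proof.
move=> st; rewrite /x' patchE memNset//= in_itv/= andbT.
by apply/negP; rewrite -leNgt.
Qed.

Let w0 t : t <= s0 -> w t = 0.
Proof. by move=> st; rewrite /w x'0// sgr0 mulr0. Qed.

Let mx' : measurable_fun setT x'.
Proof. exact: measurable_patch. Qed.

Let mX : measurable_fun setT X.
Proof. exact: measurableT_comp. Qed.

Let X01 t : 0 <= X t <= 1.
Proof. by apply: normr_patch01 => s; rewrite /= in_itv/= andbT; exact: x1. Qed.

Let iw : mu.-integrable setT (EFin \o w).
Proof.
apply: (@integrable_mul_bounded _ _ _ _ _ _ 1).
- exact: integrable_exp_weight.
- by apply: measurableT_comp => //; exact: measurable_sgr.
- by move=> t; exact: normr_sg_le1.
Qed.

Let fwX z : f z = \int[mu]_t (w t * X t `^ z%:num).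
Proof.
rewrite fE [LHS]Rintegral_mkcond; apply: eq_Rintegral => t _.
rewrite patch_indic/= /w /X /exp_weight indicE.
case: (boolP (t \in _)) => [|_]; last by rewrite !mulr0 !mul0r.
by rewrite inE /= in_itv/= andbT => st; rewrite x'E// /spow !mulr1 mulrC mulrA.
Qed.

Let r := sup [set `|x (s0 + eps)| | eps in [set` `]0, +oo[]].

Let has_sup_r : has_sup [set `|x (s0 + eps)| | eps in [set` `]0, +oo[]].
Proof.
split; first by exists `|x (s0 + 1)|, 1 => //=; rewrite in_itv/= ltr01.
exists 1 => y [e /=]; rewrite in_itv/= andbT => e0 <-{y}.
by rewrite ler_norml x1// ltrDl.
Qed.

Let r_ub s : s0 < s -> `|x s| <= r.
Proof.
move=> ss; apply: ub_le_sup; first by case: has_sup_r.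
by exists (s - s0); rewrite /= ?in_itv/= ?subr_gt0 ?ss// addrC subrK.
Qed.

Let r_gt0 : 0 < r.
Proof.
have s1 : s0 < s0 + 1 by rewrite ltrDl.
by apply: lt_le_trans (r_ub s1); rewrite normr_gt0 xn0.
Qed.

Let r_le1 : r <= 1.
Proof.
apply: ge_sup; first by case: has_sup_r.
move=> y [e /=]; rewrite in_itv/= andbT => e0 <-{y}.
by rewrite ler_norml x1// ltrDl.
Qed.

Let cvg_r : `|x (s0 + eps)| @[eps --> 0^'+] --> r.
Proof.
apply: (@nonincreasing_at_right_cvgr R (fun eps => `|x (s0 + eps)|) 0 +oo%O) => //.
- move=> e e'; rewrite !in_itv/= !andbT => e0 e'0 ee'.
  by have [] := @sx (s0 + e) (s0 + e') _ _; rewrite ?ltrDl ?lerD2l.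
- by case: has_sup_r.
Qed.

Let decays_r : decays f r.
Proof.
apply: (tail_eq0_decays (mu := mu) iw mX X01 fwX (ltW r_gt0)) => y ry.
rewrite (_ : X @^-1` _ = set0) ?Rintegral_set0//.
apply/seteqP; split => // t /=; rewrite in_itv/= andbT leNgt => /negP; apply.
apply: le_lt_trans ry; rewrite /X; have [ts|st] := leP t s0.
  by rewrite x'0// normr0 ltW.
by rewrite x'E// r_ub.
Qed.

(** Let y = |x s|. Both {X >= y} and {X > y} have mass zero, hence so has the level
    set {X = y}, on which the sign is constant; it is therefore a null set.
    Up to this null set, {X >= y} is the initial interval ]s0, s]. *)
Let initial_integral_eq0 a s1 s : decays f a -> 0 < a -> a < `|x s1| ->
  s0 < s -> s <= s1 -> \int[mu]_t (w t * \1_(`]-oo, s]%classic) t) = 0.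
Proof.
move=> fa a0 ax1 ss0 ss1; pose y := `|x s|.
have ay : a < y.
  by apply: lt_le_trans ax1 _; have [] := sx ss0 ss1.
have tail0 b : a < b -> \int[mu]_(t in X @^-1` `[b, +oo[) w t = 0.
  by move=> ab; apply: (decays_tail_eq0 iw mX X01 fwX _ fa); rewrite ltW.
have open0 := open_tail_eq0 iw mX (fun b (yb : y < b) => tail0 b (lt_trans ay yb)).
have closed0 := tail0 y ay.
rewrite Rintegral_indic in closed0.
have mC : measurable (X @^-1` `[y, +oo[) by exact: measurable_preimage.
have mO : measurable (X @^-1` `]y, +oo[) by exact: measurable_preimage.
have mL : measurable (X @^-1` [set y]) by exact: measurable_preimage.
have iC := integrable_mul_indic iw mC.
have iO := integrable_mul_indic iw mO.
have iE := integrable_exp_weight s0.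
have iL := integrable_mul_indic iE mL.
have XE t : s0 < t -> X t = `|x t| by move=> st; rewrite /X x'E.
have level0 : \int[mu]_t (exp_weight s0 t * \1_(X @^-1` [set y]) t) = 0.
  have : \int[mu]_t (Num.sg (x s) * (exp_weight s0 t * \1_(X @^-1` [set y]) t)) = 0.
    rewrite -[RHS](subrr 0) -[X in _ = X - _]closed0 -[X in _ = _ - X]open0 -RintegralB//.
    apply: eq_Rintegral => t _; rewrite -mulrBr.
    have [ts|st] := leP t s0.
      rewrite w0// mul0r /exp_weight [X in _ * X * _]indicE memNset ?mulr0 ?mul0r ?mulr0//.
      by rewrite /= in_itv/= andbT; apply/negP; rewrite -leNgt.
    have LE : (t \in X @^-1` [set y]) = (X t == y) by apply/idP/eqP; rewrite inE.
    have CE : (t \in X @^-1` `[y, +oo[) = (y <= X t).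
      by apply/idP/idP; rewrite inE /= in_itv/= andbT.
    have OE : (t \in X @^-1` `]y, +oo[) = (y < X t).
      by apply/idP/idP; rewrite inE /= in_itv/= andbT.
    rewrite [\1_(X @^-1` [set y]) t]indicE LE !indicE CE OE.
    case: (ltgtP y (X t)) => yX /=; rewrite ?subrr ?subr0 ?mulr0//.
    rewrite !mulr1 /w x'E// mulrC; congr (_ * Num.sg _).
    move: yX; rewrite XE// /y => yX; have [ts|ts] := leP t s.
      by have [_] := sx st ts; move=> ->.
    by have [_] := sx ss0 (ltW ts); move=> ->.
  rewrite RintegralZl// => /eqP; rewrite mulf_eq0 sgr_eq0 (negbTE (xn0 ss0))/=.
  by move/eqP.
have tail_level : \int[mu]_t (w t * (\1_(X @^-1` `[y, +oo[) t * \1_(`]s, +oo[%classic) t)) = 0.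
  apply/eqP; rewrite -normr_le0 -[leRHS]level0.
  apply: le_trans (le_normr_Rintegral measurableT _) _ => //.
    by under eq_fun do rewrite mulrA; exact: integrable_mul_indic.
  apply: le_Rintegral => //.
  - apply: integrable_norm.
    by under eq_fun do rewrite mulrA; exact: integrable_mul_indic.
  move=> t _; have [ts|st] := leP t s.
    rewrite [\1_(`]s, +oo[%classic) t]indicE memNset.
      by rewrite !mulr0 normr0 mulr_ge0// exp_weight_ge0.
    by rewrite /= in_itv/= andbT; apply/negP; rewrite -leNgt.
  have st0 : s0 < t by exact: lt_trans st.
  rewrite normrM ler_pM//.
    rewrite normrM (ger0_norm (exp_weight_ge0 _ _)) ler_piMr ?exp_weight_ge0//.
    exact: normr_sg_le1.
  rewrite mul_indic ger0_norm// !indicE ler_nat.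
  case: (boolP (t \in _)) => // ; rewrite inE => -[/= + _]; rewrite in_itv/= andbT => yX.
  rewrite mem_set//=; apply/eqP; rewrite eq_le yX andbT XE//.
  by have [] := sx ss0 (ltW st).
rewrite -[RHS](subrr 0) -[X in _ = X - _]closed0 -[X in _ = _ - X]tail_level.
rewrite -RintegralB//; last first.
  by under eq_fun do rewrite mulrA; exact: integrable_mul_indic.
apply: eq_Rintegral => t _; rewrite -mulrBr.
have [ts0|st0] := leP t s0; first by rewrite w0// !mul0r.
congr (_ * _).
have CE : (t \in X @^-1` `[y, +oo[) = (y <= X t).
  by apply/idP/idP; rewrite inE /= in_itv/= andbT.
rewrite !indicE CE !mem_setE !in_itv/= !andbT.
have [ts|st] := leP t s; last by rewrite mulr1 subrr.
by rewrite mulr0 subr0 XE// /y; have [-> _] := sx st0 ts.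
Qed.

(** If f decayed at a rate a < r, then w would have integral zero on all initial
    intervals of a nonempty ]s0, s1], hence vanish against its own sign
    there. The variable - t turns initial intervals into tails. *)
Let r_minimal a : 0 < a -> decays f a -> r <= a.
Proof.
move=> a0 fa; rewrite leNgt; apply/negP => ar.
have ra0 : 0 < r - a by rewrite subr_gt0.
have [_ [e e0 <-]] := sup_adherent ra0 has_sup_r.
rewrite -/r opprB addrC subrK => ax1; pose s1 := s0 + e.
have s01 : s0 < s1 by move: e0; rewrite /= in_itv/= andbT /s1 ltrDl.
have init0 := initial_integral_eq0 fa a0 ax1.
pose w' t := w t * \1_(`]-oo, s1]%classic) t.
have iw' : mu.-integrable setT (EFin \o w') by exact: integrable_mul_indic.
have sg0 : \int[mu]_t (w' t * Num.sg (x' (- - t))) = 0.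
  rewrite (@Rintegral_transfer _ _ _ _ R mu mu w' (fun t => - t) (cst 0) (fun t => - t)
    iw' _ _ _ _ _ (fun u => Num.sg (x' (- u))) 1).
  - by under eq_Rintegral do rewrite mul0r; rewrite Rintegral_cst// mul0r.
  - exact: integrable0.
  - exact: measurable_funN.
  - exact: measurable_funN.
  - by rewrite /w' init0// Rintegral_cst// mul0r.
  - move=> y; rewrite [RHS]Rintegral_cst ?mul0r; last first.
      have mN : measurable_fun setT (fun t : R => - t) by exact: measurable_funN.
      by rewrite -[X in measurable X]setTI; exact: mN.
    rewrite Rintegral_indic; pose s := Num.min s1 (- y).
    transitivity (\int[mu]_t (w t * \1_(`]-oo, s]%classic) t)).
      apply: eq_Rintegral => t _; rewrite /w' -mulrA mul_indic; congr (_ * \1_ _ t).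
      apply/seteqP; split => u; rewrite /= !in_itv/= !andbT /s le_min lerNr.
        by move=> [-> ->].
      by move=> /andP[-> ->].
    have [ss0|s0s] := leP s s0; last by rewrite init0// ge_min lexx.
    transitivity (\int[mu]_t (0 : R)); last by rewrite Rintegral_cst// mul0r.
    apply: eq_Rintegral => t _; have [ts0|st0] := leP t s0; first by rewrite w0// mul0r.
    rewrite indicE memNset ?mulr0//= in_itv/=; apply/negP; rewrite -ltNge.
    exact: le_lt_trans ss0 st0.
  - apply: measurableT_comp; first exact: measurable_sgr.
    by apply: measurableT_comp => //; exact: measurable_funN.
  - by move=> u; exact: normr_sg_le1.
have : \int[mu]_t (exp_weight s0 t - exp_weight s1 t) = 0.
  rewrite -[RHS]sg0; apply: eq_Rintegral => t _.
  rewrite opprK /w' /w /exp_weight !indicE !mem_setE !in_itv/= !andbT.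
  have [st0|ts0] := ltP s0 t; last first.
    by rewrite ltNge (le_trans ts0 (ltW s01))/= !mulr0 subrr !mul0r.
  have sg1 : Num.sg (x' t) * Num.sg (x' t) = 1.
    by rewrite -expr2 sqr_sg x'E// xn0.
  have [st1|ts1] := ltP s1 t; first by rewrite subrr mulr0 mul0r.
  by rewrite !mulr1 mulr0 subr0 -mulrA sg1 mulr1.
rewrite RintegralB//; [|exact: integrable_exp_weight|exact: integrable_exp_weight].
rewrite !Rintegral_exp_weight => /eqP; rewrite subr_eq0 => /eqP/expR_inj/oppr_inj s0s1.
by move: s01; rewrite s0s1 ltxx.
Qed.

Lemma canonical_rate : exists r : R, [/\ 0 < r <= 1,
  `|x (s0 + eps)| @[eps --> 0^'+] --> r, decays f r &
  forall a, 0 < a -> decays f a -> r <= a].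
Proof. by exists r; split => //; rewrite r_gt0. Qed.

End canonical_rate.

(** The least rate of decay depends on f only, so all canonical forms of f have
    the same limit. *)
Lemma absrhoP (R : realType) (f : {posnum R} -> R) : Bbp_nonzero f ->
  [/\ 0 < absrho f <= 1, decays f (absrho f),
   forall a, 0 < a -> decays f a -> absrho f <= a &
   forall (s0 : R) (x : R -> R), canonical_form f s0 x ->
           `|x (s0 + eps)| @[eps --> 0^'+] --> absrho f].
Proof.
move=> fn0; have [s1 [x1 cf1]] := canonical_form_exists fn0.
rewrite /absrho; set p := xget _ _.
have cfp : canonical_form f p.1 p.2.
  exact: (@xgetPex _ (0, fun=> 1) [set p : R * (R -> R) | canonical_form f p.1 p.2]
    (ex_intro _ (s1, x1) cf1)).
have [r [r01 cr fr rmin]] := canonical_rate cfp.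
have -> : lim (`|p.2 (p.1 + eps)| @[eps --> 0^'+]) = r by exact: cvg_lim cr.
split => // s0 x cf; have [r' [/andP[r'0 _] cr' fr' r'min]] := canonical_rate cf.
suff -> : r = r' by [].
have /andP[r0 _] := r01.
by apply/eqP; rewrite eq_le rmin// r'min.
Qed.

Theorem theorem5p6 (R : realType) :
  (forall f : {posnum R} -> R, Bbp_nonzero f ->
     [/\ exists s0 : R, exists x : R -> R, canonical_form f s0 x,
         forall (s0 : R) (x : R -> R), canonical_form f s0 x ->
           `|x (s0 + eps)| @[eps --> 0^'+] --> absrho f &
         0 < absrho f <= 1]) /\
  (forall f g : {posnum R} -> R, Bbp_nonzero f -> Bbp_nonzero g ->
     Bbp_nonzero (f \* g) /\ absrho (f \* g) = absrho f * absrho g).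
Proof.
split=> [f fn0|f g fn0 gn0].
  have [r01 _ _ cvgr] := absrhoP fn0.
  by split => //; exact: canonical_form_exists.
have [f01 fd fmin _] := absrhoP fn0; have [g01 gd gmin _] := absrhoP gn0.
have /andP[f0 _] := f01; have /andP[g0 _] := g01.
have fg0 : 0 < absrho f * absrho g by rewrite mulr_gt0.
have [Bf _] := fn0; have [Bg _] := gn0.
have lower c : 0 < c -> decays (f \* g) c -> absrho f * absrho g <= c.
  exact: decays_mul_ge.
have fgn0 : Bbp_nonzero (f \* g).
  split; first exact: Bbp_mul.
  move=> fgE; have := lower (absrho f * absrho g / 2).
  rewrite leNgt ltr_pdivrMr// ltr_pMr// ltr1n => h; have : false; last by [].
  apply: h; first by rewrite divr_gt0.
  by exists 0 => z; rewrite fgE normr0 mul0r.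
split=> //; have [/andP[fg0' _] fgd fgmin _] := absrhoP fgn0.
apply/eqP; rewrite eq_le lower// fgmin//.
have [C fC] := fd; have [D gD] := gd; exists (C * D) => z /=.
rewrite normrM powRM; [|exact: ltW|exact: ltW].
by rewrite mulrACA ler_pM.
Qed.
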